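(* Let $\mathcal{G}$ be an acyclic directed mixed graph with vertex set $V$, and let $P$ be a probability distribution on $\{0,1\}^{|V|}$. Then $P$ obeys the global Markov property with respect to $\mathcal{G}$ if and only if for every ancestral set $A$ of $\mathcal{G}$ and every $x_A\in\mathfrak{X}_A=\{0,1\}^{A}$, $$P(X_A=x_A)=\sum_{C:\,O\subseteq C\subseteq A}(-1)^{|C\setminus O|}\prod_{H\in[C]_{\mathcal{G}}}P(X_H=0\mid X_T=x_T),$$ where $O=\{v\in A: x_v=0\}$ and $T=\operatorname{tail}_{\mathcal{G}}(H)$ for each head $H$.
   Context: **Graphs.** An acyclic directed mixed graph (ADMG) $\mathcal{G}$ consists of a finite vertex set $V$, a set of directed edges $v\to w$ ($v\neq w$) with no directed cycles, and a set of bidirected edges $v\leftrightarrow w$ (unordered pairs of distinct vertices); a pair may be joined by both a directed and a bidirected edge. For $A\subseteq V$, $\mathcal{G}_A$ is the induced subgraph on $A$. A path is a sequence of adjacent edges without repetition of a vertex (possibly empty). $\operatorname{pa}_{\mathcal{G}}(v)=\{w: w\to v\}$; $\operatorname{an}_{\mathcal{G}}(v)$ is the set of $w$ with a (possibly empty) directed path from $w$ to $v$, so $v\in\operatorname{an}_{\mathcal{G}}(v)$; $\operatorname{de}_{\mathcal{G}}(v)=\{w: v\in\operatorname{an}_{\mathcal{G}}(w)\}$; the district $\operatorname{dis}_{\mathcal{G}}(v)$ is the set of vertices joined to $v$ by a path consisting only of bidirected edges, including $v$. These are applied to sets by taking unions. $\operatorname{dis}_A$ means $\operatorname{dis}_{\mathcal{G}_A}$.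 A set $A$ is ancestral if $A=\operatorname{an}_{\mathcal{G}}(A)$. $\operatorname{barren}_{\mathcal{G}}(B)=\{v\in B:\operatorname{de}_{\mathcal{G}}(v)\cap B=\{v\}\}$, and $B$ is barren if $B=\operatorname{barren}_{\mathcal{G}}(B)$. **Heads, tails, partition.** A (nonempty) set $H\subseteq V$ is a head if it is barren and is contained within a single district of $\mathcal{G}_{\operatorname{an}(H)}$. The tail of $H$ is $\operatorname{tail}_{\mathcal{G}}(H)=(\operatorname{dis}_{\operatorname{an}(H)}(H)\setminus H)\cup\operatorname{pa}_{\mathcal{G}}(\operatorname{dis}_{\operatorname{an}(H)}(H))$. For distinct heads, $H_i\prec H_j$ if $H_i\subseteq\operatorname{an}_{\mathcal{G}}(H_j)$. For $W\subseteq V$ let $\Phi_{\mathcal{G}}(W)$ be the set of heads $H\subseteq W$ such that $H\nprec H'$ for all other heads $H'\subseteq W$, and $\psi_{\mathcal{G}}(W)=W\setminus\bigcup_{C\in\Phi_{\mathcal{G}}(W)}C$. Define recursively $[\varnothing]_{\mathcal{G}}=\varnothing$ and $[W]_{\mathcal{G}}=\Phi_{\mathcal{G}}(W)\cup[\psi_{\mathcal{G}}(W)]_{\mathcal{G}}$. **Markov property.** A non-endpoint vertex on a path is a collider if both adjacent edges on the path have an arrowhead at it, and otherwise a non-collider. A path between $v,w$ is blocked by $C\subseteq V\setminus\{v,w\}$ if some non-collider on it is in $C$, or some collider on it is not in $\operatorname{an}_{\mathcal{G}}(C)$. Disjoint sets $A,B$ are m-separated given $C\subseteq V\setminus(A\cup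 B)$ if for all $a\in A$, $b\in B$ every path from $a$ to $b$ is blocked by $C$. $P$ satisfies the global Markov property for $\mathcal{G}$ if for all disjoint $A,B,C\subseteq V$ with $A,B$ nonempty, $A$ m-separated from $B$ given $C$ implies $X_A\perp\!\!\!\perp X_B\mid X_C$ under $P$ ($C$ may be empty). **Probability.** $X_V=(X_v)_{v\in V}$ is a vector of binary random variables with distribution $P$, and $X_A=(X_v)_{v\in A}$; $X_H=0$ means $X_v=0$ for all $v\in H$. Conditional probabilities given $X_T=x_T$ are defined for $P(X_T=x_T)>0$, in general being any version (any member of the equivalence class) of the conditional distribution. Empty products equal 1.
   Formalization: The formula is required only at those x_A for which every conditioning event X_T = x_T occurring in the sum has positive probability; at other x_A, where P(X_A = x_A) = 0, the sum depends on the chosen versions and the equality can fail for a Markov P. *)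

(* Defs.v *)
From HB Require Import structures.
From mathcomp Require Import all_boot all_order all_algebra.
Set Implicit Arguments.
Unset Strict Implicit.
Unset Printing Implicit Defensive.
Import Order.TTheory GRing.Theory Num.Theory.
Local Open Scope ring_scope.

(* [dir v w] is v -> w and [bi v w] is v <-> w.  [ucycle dir p] says that the
   sequence p of distinct vertices is a closed directed walk, so [admg_acyclic]
   also excludes loops v -> v. *)
Record admg (V : finType) := Admg {
  dir : rel V;
  bi : rel V;
  bi_sym : symmetric bi;
  bi_irr : irreflexive bi;
  admg_acyclic : forall p : seq V, ucycle dir p -> p = [::]
}.

Section Graph.
Variables (V : finType) (G : admg V).
Implicit Types (v w x : V) (A B C H W : {set V}).

Definition an B : {set V} := [set w | [exists v in B, connect (dir G) w v]].
Definition de B : {set V} := [set w | [exists v in B, connect (dir G) v w]].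
Definition pa B : {set V} := [set w | [exists v in B, dir G w v]].

Definition ancestral A : bool := A == an A.

(* Districts of the induced subgraph on A, for B a subset of A. *)
Definition bi_in A : rel V := [rel v w | [&& v \in A, w \in A & bi G v w]].
Definition dis A B : {set V} :=
  [set w in A | [exists v in B, connect (bi_in A) v w]].

Definition barren B : {set V} := [set v in B | de [set v] :&: B == [set v]].

Definition is_head H : bool :=
  [&& H != set0, H == barren H
    & [exists v in an H, H \subset dis (an H) [set v]]].

Definition head_tail H : {set V} :=
  (dis (an H) H :\: H) :|: pa (dis (an H) H).

Definition prec H1 H2 : bool := (H1 != H2) && (H1 \subset an H2).

Definition Phi W : {set {set V}} :=
  [set H : {set V} | [&& is_head H, H \subset W
    & [forall H' : {set V}, is_head H' && (H' \subset W) ==> ~~ prec H H']]].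

Definition psi W : {set V} := W :\: \bigcup_(C in Phi W) C.

(* [hpart W] is the partition [W]_G.  The recursion [W] = Phi(W) u [psi(W)]
   runs on fuel #|W|; [hpart0] and [hpartE] below are the defining equations,
   and show that this fuel suffices. *)
Fixpoint hpart_rec (n : nat) W : {set {set V}} :=
  if n is n'.+1 then Phi W :|: hpart_rec n' (psi W) else set0.

Definition hpart W : {set {set V}} := hpart_rec #|W| W.

(* A path out of a vertex x is the sequence of its steps, a step being the
   orientation of the edge in the direction of travel and the vertex reached:
   two vertices may be joined by two edges, so vertices do not determine it. *)
Inductive orient := Fwd | Bwd | Bid.

Definition edge (o : orient) : rel V :=
  match o with
  | Fwd => fun v w => dir G v w
  | Bwd => fun v w => dir G w v
  | Bid => fun v w => bi G v w
  end.

Fixpoint mwalk x (p : seq (orient * V)) : bool :=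
  if p is (o, y) :: p' then edge o x y && mwalk y p' else true.

Definition mpath x (p : seq (orient * V)) : bool :=
  mwalk x p && uniq (x :: map snd p).

Definition arrow_at_target (o : orient) : bool :=
  if o is Bwd then false else true.
Definition arrow_at_source (o : orient) : bool :=
  if o is Fwd then false else true.

Definition collider (o1 o2 : orient) : bool :=
  arrow_at_target o1 && arrow_at_source o2.

Fixpoint blocked C (p : seq (orient * V)) : bool :=
  match p with
  | (o1, v) :: (((o2, _) :: _) as p') =>
      (if collider o1 o2 then v \notin an C else v \in C) || blocked C p'
  | _ => false
  end.

Definition m_separated A B C : Prop :=
  forall (a b : V) (p : seq (orient * V)), a \in A -> b \in B ->
    mpath a p -> last a (map snd p) = b -> blocked C p.

End Graph.

(* Outcomes in {0,1}^V, with [false] for 0.  An outcome of a subvector X_A is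
   given by any x : state V, of which only the coordinates in A matter. *)
Notation state V := {ffun V -> bool}.

Section Probability.
Variables (R : realFieldType) (V : finType).
Implicit Types (P : state V -> R) (E F : {set state V}) (x : state V).

Definition is_prob P : Prop := (forall x, 0 <= P x) /\ \sum_x P x = 1.

Definition pr P E : R := \sum_(x in E) P x.

(* The events X_A = x_A and X_A = 0. *)
Definition ev (A : {set V}) x : {set state V} :=
  [set y : state V | [forall v in A, y v == x v]].
Definition ev0 (A : {set V}) : {set state V} := ev A [ffun=> false].

Definition cpr P E F : R := pr P (E :&: F) / pr P F.

Definition cond_indep P (A B C : {set V}) : Prop :=
  forall x, 0 < pr P (ev C x) ->
    cpr P (ev A x :&: ev B x) (ev C x)
    = cpr P (ev A x) (ev C x) * cpr P (ev B x) (ev C x).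

(* q is a version of x_T |-> P(E | X_T = x_T): a function of the coordinates
   in T whose values at the null x_T are arbitrary. *)
Definition cond_version P E (T : {set V}) (q : state V -> R) : Prop :=
  (forall x (y : state V), {in T, x =1 y} -> q x = q y) /\
  (forall x, 0 < pr P (ev T x) -> q x = cpr P E (ev T x)).

Definition global_markov (G : admg V) P : Prop :=
  forall A B C : {set V},
    [disjoint A & B] -> [disjoint A & C] -> [disjoint B & C] ->
    A != set0 -> B != set0 -> m_separated G A B C -> cond_indep P A B C.

Definition zeros (A : {set V}) x : {set V} := [set v in A | ~~ x v].

(* Every conditional probability in the expansion of P(X_A = x_A) conditions
   on an event of positive probability.  If not, then P(X_A = x_A) = 0 while
   the expansion depends on the versions chosen, and it need not vanish: take
   edges a -> d, b -> c, c <-> a, d <-> b and a point mass at 0; at x = 1 the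
   expansion over all four vertices is
     (q_{a,c}(b=1) - q_c(b=1)) * (q_{b,d}(a=1) - q_d(a=1)),
   and all four values are arbitrary. *)
Definition expansion_defined (G : admg V) P (A : {set V}) x : Prop :=
  forall C H : {set V}, zeros A x \subset C -> C \subset A -> H \in hpart G C ->
    0 < pr P (ev (head_tail G H) x).

End Probability.

Section RecursivePartition.
Variables (V : finType) (G : admg V).
Implicit Types (v w : V) (A B H W : {set V}).

Lemma dir_connect_anti : antisymmetric (connect (dir G)).
Proof.
move=> v w /andP[/connectP[p pp ew] wv].
case: p pp ew => [_ -> | a p] //= /andP[va ap] ew.
have /connectP[q aq eq] : connect (dir G) a v.
  by apply: connect_trans wv; rewrite ew; apply/connectP; exists p.
case/shortenP: aq eq => r ar ur _ er.
have /(admg_acyclic (p := a :: r)) // : ucycle (dir G) (a :: r).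
by rewrite /ucycle ur andbT /= rcons_path ar -er.
Qed.

Lemma head1 v : is_head G [set v].
Proof.
have vA : v \in an G [set v].
  by rewrite inE; apply/exists_inP; exists v; rewrite ?inE.
apply/and3P; split; first by apply/set0Pn; exists v; rewrite inE.
  rewrite eqEsubset; apply/andP; split;
    last by apply/subsetP=> w /setIdP[].
  apply/subsetP=> w /set1P ->; rewrite !inE eqxx /=.
  rewrite eqEsubset subsetIr sub1set !inE eqxx andbT.
  by apply/exists_inP; exists v; rewrite ?inE.
apply/exists_inP; exists v => //; rewrite sub1set inE vA.
by apply/exists_inP; exists v; rewrite ?inE.
Qed.

Lemma head_an_inj H1 H2 : is_head G H1 -> is_head G H2 ->
  H1 \subset an G H2 -> H2 \subset an G H1 -> H1 = H2.
Proof.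
have sub A B : is_head G A -> A \subset an G B -> B \subset an G A -> A \subset B.
  case/and3P=> _ /eqP bA _ /subsetP AB /subsetP BA; apply/subsetP=> v vA.
  have /exists_inP[w wB vw] : [exists w in B, connect (dir G) v w].
    by have := AB v vA; rewrite inE.
  have /exists_inP[u uA wu] : [exists u in A, connect (dir G) w u].
    by have := BA w wB; rewrite inE.
  have uv : u = v.
    move: vA; rewrite bA inE => /andP[_ /eqP/setP/(_ u)].
    rewrite in_setI uA andbT !inE => e; apply/eqP; rewrite -e.
    by apply/exists_inP; exists v; rewrite ?inE //; apply: connect_trans wu.
  suff -> : v = w by [].
  by apply: dir_connect_anti; rewrite vw -uv.
by move=> h1 h2 s12 s21; apply/eqP; rewrite eqEsubset; apply/andP; split; exact: sub.
Qed.

Lemma an_mono A B : A \subset an G B -> an G A \subset an G B.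
Proof.
move=> /subsetP AB; apply/subsetP=> v; rewrite inE => /exists_inP[w /AB].
rewrite !inE => /exists_inP[u uB wu] vw; apply/exists_inP; exists u => //.
exact: connect_trans wu.
Qed.

Lemma sub_an A : A \subset an G A.
Proof. by apply/subsetP=> v vA; rewrite inE; apply/exists_inP; exists v. Qed.

Lemma Phi_neq0 W : W != set0 -> Phi G W != set0.
Proof.
case/set0Pn=> v vW.
have P1 : is_head G [set v] && ([set v] \subset W) by rewrite head1 sub1set.
case: (arg_maxnP (P := fun H => is_head G H && (H \subset W))
                 (fun H => #|an G H|) P1) => H /andP[hH HW] Hmax.
apply/set0Pn; exists H; rewrite inE hH HW /=.
apply/forallP=> H'; apply/implyP=> hW'; apply/negP=> /andP[ne HH'].
have le : (#|an G H'| <= #|an G H|)%N := Hmax _ hW'.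
have e : an G H = an G H' by apply/eqP; rewrite eqEcard an_mono.
by move/eqP: ne; apply; apply: head_an_inj; rewrite ?e ?sub_an //; case/andP: hW'.
Qed.

Lemma Phi0 : Phi G set0 = set0.
Proof.
apply/setP=> H; rewrite !inE subset0; apply/negP=> /and3P[/and3P[h _ _] H0 _].
by rewrite H0 in h.
Qed.

Lemma psi_card W : W != set0 -> (#|psi G W| < #|W|)%N.
Proof.
move=> W0; have /set0Pn[H HP] := Phi_neq0 W0.
have: H \in Phi G W by []; rewrite inE => /and3P[/and3P[/set0Pn[v vH] _ _] HW _].
apply: proper_card; apply/properP; split; first exact: subsetDl.
exists v; first exact: (subsetP HW).
by rewrite inE negb_and negbK; apply/orP; left; apply/bigcupP; exists H.
Qed.

Lemma hpart_rec0 n : hpart_rec G n set0 = set0.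
Proof. by elim: n => //= n IH; rewrite Phi0 set0U /psi set0D. Qed.

Lemma hpart_recE n W : (#|W| <= n)%N -> hpart_rec G n W = hpart G W.
Proof.
rewrite /hpart; elim/ltn_ind: n W => -[|n] IH W Wn.
  by move: Wn; rewrite leqn0 => /eqP ->.
have [->|W0] := eqVneq W set0; first by rewrite !hpart_rec0.
have := psi_card W0; case: #|W| Wn => [|m] // mn; rewrite ltnS => pm /=.
by rewrite (IH n) ?(IH m) // (leq_trans pm).
Qed.

Lemma hpart0 : hpart G set0 = set0.
Proof. by rewrite /hpart cards0. Qed.

Lemma hpartE W : hpart G W = Phi G W :|: hpart G (psi G W).
Proof.
have [->|W0] := eqVneq W set0; first by rewrite Phi0 /psi set0D hpart0 set0U.
have lt := psi_card W0; rewrite {1}/hpart; case eW: #|W| lt => [|m] //= lt.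
by rewrite hpart_recE.
Qed.

End RecursivePartition.

(* Main.v *)
Require Import Defs.
From mathcomp Require Import all_boot all_order all_algebra.
From mathcomp Require Import zify ring.
Set Implicit Arguments.
Unset Strict Implicit.
Unset Printing Implicit Defensive.
Import Order.TTheory GRing.Theory Num.Theory.
Local Open Scope ring_scope.

(**
Write F(W) for the expansion over a set W of vertices: the alternating sum over
the sets C between the zeros of x in W and W, of the products of the q H over
the heads H of the partition of C.  Two facts drive the proof.

First, F is multiplicative over districts.  A head contained in an ancestral
set A lies in one district of the induced subgraph on A; maximal heads are
disjoint and may be removed one at a time in any order ([hpart_Phi]); hence the
partition of C splits along the districts of A ([hpart_split]), and
F(A) = F(D) F(A \ D) when D is a union of districts ([expansion_district]).
The factor F(D) depends only on the coordinates in D and in the parents of D.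

Second, the maximal elements H of a district D of A form a head, whose tail is
[district_tail D], that is D \ H together with the parents of D, and
[district_tail] is monotone.  Every tail that occurs in the expansion over A
lies in one of these, and these occur, so the hypothesis that the expansion is
defined at x says exactly that x has positive probability on the tail of each
district of A ([expansion_definedE]).

From the Markov property to the expansion ([markov_expansion]): induct on A.
If a maximal element of A takes value 1, subtract the outcome with value 0
there from the marginal without that vertex.  Otherwise choose a maximal v with
district D.  If A is the set of ancestors of D, the maximal elements of A form
a head H that belongs to every partition in the sum, so q H factors out, and
the Markov property factors the probability in the same way ([markov_head]).
If not, the ancestors A1 of D form a smaller set.  Multiplicativity gives
F(A) / F(A \ v) = F(D) / F(D \ v) = F(A1) / F(A1 \ v), and the Markov property
gives the same equality of ratios for the probabilities of x on these sets
([markov_district]).  To divide when probabilities vanish, the coordinates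
outside D and its parents are replaced by those of an outcome of positive
probability; F(D) does not see the change.

From the expansion to the Markov property ([expansion_markov]): let A0 be the
ancestors of A, B and C, where A and B are m-separated given C.  Let S be the
set of the vertices of A0 outside C that unblocked walks from A reach.  It
contains A and misses B, since a shortest unblocked walk is a path
([open_walk_uniq]).  If it meets a district of A0 or its parents, then it
contains all of them that are outside C ([reach_set_closed]).  So grouping the
districts of A0 into those that meet S, themselves or by a parent, and the
others factors P(X_A0 = x) into a function of the coordinates in S and C and a
function of those outside S.  Such a factorization gives the independence with
no positivity assumption ([factor_cond_indep]).
*)

(** * Ancestral and barren sets *)

Section Heads.
Variables (V : finType) (G : admg V).
Implicit Types (u v w : V) (A B C D E H W : {set V}).

Lemma anP v B :
  reflect (exists2 w, w \in B & connect (dir G) v w) (v \in an G B).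
Proof. by rewrite inE; apply: exists_inP. Qed.

Lemma paP v B : reflect (exists2 w, w \in B & dir G v w) (v \in pa G B).
Proof. by rewrite inE; apply: exists_inP. Qed.

Lemma anS A B : A \subset B -> an G A \subset an G B.
Proof. by move=> AB; apply/an_mono/(subset_trans AB)/sub_an. Qed.

Lemma an_ancestral B : ancestral G (an G B).
Proof. by rewrite /ancestral eqEsubset sub_an an_mono. Qed.

Lemma ancestral_sub A B : ancestral G A -> B \subset A -> an G B \subset A.
Proof. by move=> /eqP {2}-> /anS. Qed.

Lemma ancestral_connect A u v :
  ancestral G A -> v \in A -> connect (dir G) u v -> u \in A.
Proof. by move=> /eqP {2}-> vA uv; apply/anP; exists v. Qed.

Lemma ancestral_dir A u v : ancestral G A -> v \in A -> dir G u v -> u \in A.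
Proof. by move=> aA vA uv; apply: (ancestral_connect aA vA); apply: connect1. Qed.

Lemma an_connect B u v : v \in an G B -> connect (dir G) u v -> u \in an G B.
Proof. exact: ancestral_connect (an_ancestral B). Qed.

Lemma pa_sub A D : ancestral G A -> D \subset A -> pa G D \subset A.
Proof.
move=> aA /subsetP DA; apply/subsetP=> u /paP[w wD uw].
exact: ancestral_dir (DA _ wD) uw.
Qed.

Lemma paS D E : D \subset E -> pa G D \subset pa G E.
Proof.
by move=> /subsetP DE; apply/subsetP=> u /paP[w /DE wE uw]; apply/paP; exists w.
Qed.

Lemma dir_irr u : dir G u u = false.
Proof.
apply/negP=> uu; have: ucycle (dir G) [:: u] by rewrite /ucycle /= uu.
by move/admg_acyclic.
Qed.

Lemma barrenP v B :
  reflect (v \in B /\ forall w, w \in B -> connect (dir G) v w -> w = v)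
          (v \in barren G B).
Proof.
rewrite inE; apply: (iffP andP) => -[vB].
  move/eqP/setP=> e; split=> // w wB vw; have := e w; rewrite !inE wB andbT.
  by case: exists_inP => [_ /esym/eqP //|[]]; exists v; rewrite ?inE.
move=> h; split=> //; apply/eqP/setP=> w; rewrite !inE.
apply/andP/eqP=> [[/exists_inP[u /set1P -> vw] wB]|->]; first exact: h.
by split=> //; apply/exists_inP; exists v; rewrite ?inE.
Qed.

Lemma barren_sub B : barren G B \subset B.
Proof. by apply/subsetP=> v /barrenP[]. Qed.

Lemma barren_dir v w B : v \in barren G B -> w \in B -> dir G v w = false.
Proof.
move=> /barrenP[_ h] wB; apply/negP=> vw.
by have e := h w wB (connect1 vw); rewrite e dir_irr in vw.
Qed.

Lemma barrenS v A B : B \subset A -> v \in B -> v \in barren G A -> v \in barren G B.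
Proof.
by move=> /subsetP BA vB /barrenP[_ h]; apply/barrenP; split=> // w /BA; apply: h.
Qed.

(** Among the descendants of [v] in [B], one with the fewest descendants is
maximal in [B], by acyclicity. *)
Lemma connect_barren v B :
  v \in B -> exists2 w, w \in barren G B & connect (dir G) v w.
Proof.
move=> vB; have Pv : (v \in B) && connect (dir G) v v by rewrite vB connect0.
case: (arg_minnP (P := fun w => (w \in B) && connect (dir G) v w)
                 (fun w => #|[set u | connect (dir G) w u]|) Pv).
move=> w /andP[wB vw] wmin; exists w => //; apply/barrenP; split=> // u uB wu.
apply/eqP; apply/negPn/negP=> uw.
have := wmin u; rewrite uB (connect_trans vw wu) => /(_ isT).
apply/negP; rewrite -ltnNge; apply: proper_card; apply/properP; split.
  by apply/subsetP=> t; rewrite !inE; apply: connect_trans.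
exists w; rewrite !inE ?connect0 //; apply/negP=> cuw; move/eqP: uw; apply.
by apply: (@dir_connect_anti _ G); rewrite cuw wu.
Qed.

Lemma an_barren B : an G (barren G B) = an G B.
Proof.
apply/eqP; rewrite eqEsubset anS ?barren_sub //=; apply: an_mono.
by apply/subsetP=> v /connect_barren[w wB vw]; apply/anP; exists w.
Qed.

Lemma barren_id B : barren G (barren G B) = barren G B.
Proof.
apply/eqP; rewrite eqEsubset barren_sub; apply/subsetP=> v vB.
exact: (barrenS (barren_sub _) vB vB).
Qed.

Lemma barren_eq0 B : (barren G B == set0) = (B == set0).
Proof.
apply/eqP/eqP=> [e|->]; last by apply/eqP; rewrite -subset0 barren_sub.
apply/eqP; rewrite -subset0; apply/subsetP=> v /connect_barren[w].
by rewrite e inE.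
Qed.

Lemma barren_an B : barren G (an G B) = barren G B.
Proof.
apply/setP=> v; apply/idP/idP=> /barrenP[].
  move=> /anP[w wB vw] h.
  have e : w = v by apply: h => //; apply: (subsetP (sub_an G B)).
  rewrite e in wB; apply/barrenP; split=> // u uB vu.
  by apply: h => //; apply: (subsetP (sub_an G B)).
move=> vB h; apply/barrenP; split; first exact: (subsetP (sub_an G B)).
move=> w /anP[u uB wu] vw; have e := h u uB (connect_trans vw wu).
by apply: (@dir_connect_anti _ G); rewrite vw -{1}e wu.
Qed.

Lemma ancestral_setD A B :
  ancestral G A -> B \subset barren G A -> ancestral G (A :\: B).
Proof.
move=> aA BA; rewrite /ancestral eqEsubset sub_an; apply/subsetP=> v.
case/anP=> w /setDP[wA wB] vw; rewrite inE (ancestral_connect aA wA vw) andbT.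
apply/negP=> vB; have /barrenP[_ h] := subsetP BA v vB.
by move: wB; rewrite (h w wA vw) vB.
Qed.

(** * Districts *)

(** [D] is a union of districts of the induced subgraph on [A]. *)
Definition district_union A D : Prop :=
  D \subset A /\ forall u w, u \in D -> w \in A -> bi G u w -> w \in D.

Lemma bi_in_sym A : symmetric (bi_in G A).
Proof. by move=> u w; rewrite /bi_in /= bi_sym andbCA. Qed.

Lemma bi_connect_sym A : connect_sym (bi_in G A).
Proof. exact/sym_connect_sym/bi_in_sym. Qed.

Lemma bi_connectS A B u w :
  A \subset B -> connect (bi_in G A) u w -> connect (bi_in G B) u w.
Proof.
move=> /subsetP AB; apply: connect_sub => s t /and3P[/AB sB /AB tB st].
by apply: connect1; rewrite /bi_in /= sB tB.
Qed.

Lemma district_union_path A D u p : district_union A D -> u \in D ->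
  path (bi_in G A) u p -> path (bi_in G D) u p && (last u p \in D).
Proof.
case=> _ h; elim: p u => //= w p IH u uD /andP[/and3P[_ wA uw] pw].
by have wD := h u w uD wA uw; rewrite /bi_in /= uD wD uw /= IH.
Qed.

Lemma district_union_connect A D u w : district_union A D -> u \in D ->
  connect (bi_in G A) u w -> connect (bi_in G D) u w /\ w \in D.
Proof.
move=> dD uD /connectP[p pp ->].
have /andP[pD lD] := district_union_path dD uD pp.
by split=> //; apply/connectP; exists p.
Qed.

Lemma disP A v w :
  reflect (w \in A /\ connect (bi_in G A) w v) (w \in dis G A [set v]).
Proof.
rewrite inE; apply: (iffP andP) => -[wA].
  by case/exists_inP=> u /set1P -> vw; split; rewrite // bi_connect_sym.
by rewrite bi_connect_sym => vw; split=> //; apply/exists_inP; exists v; rewrite ?inE.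
Qed.

Lemma dis_self A v : v \in A -> v \in dis G A [set v].
Proof. by move=> vA; apply/disP. Qed.

Lemma dis_sub A v : dis G A [set v] \subset A.
Proof. by apply/subsetP=> w /disP[]. Qed.

Lemma dis_district_union A v : district_union A (dis G A [set v]).
Proof.
split; first exact: dis_sub.
move=> u w /disP[uA uv] wA uw; apply/disP; split=> //.
apply: connect_trans uv; apply: connect1.
by rewrite /bi_in /= wA uA bi_sym.
Qed.

Lemma district_unionD A D : district_union A D -> district_union A (A :\: D).
Proof.
case=> DA h; split; first exact: subsetDl.
move=> u w /setDP[uA uD] wA uw; rewrite inE wA andbT.
by apply: contra uD => wD; apply: (h w); rewrite // bi_sym.
Qed.

Lemma district_unionI A B D :
  district_union A D -> B \subset A -> district_union B (D :&: B).
Proof.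
case=> DA h /subsetP BA; split; first exact: subsetIr.
move=> u w /setIP[uD uB] wB uw; rewrite inE wB andbT.
exact: (h u w uD (BA _ wB) uw).
Qed.

Lemma disS A B v : B \subset A -> v \in B -> dis G B [set v] \subset dis G A [set v].
Proof.
move=> BA vB; apply/subsetP=> w /disP[wB wv]; apply/disP; split.
  exact: (subsetP BA).
exact: bi_connectS wv.
Qed.

Lemma district_union_dis A D v :
  district_union A D -> v \in D -> dis G A [set v] \subset D.
Proof.
move=> dD vD; apply/subsetP=> w /disP[wA]; rewrite bi_connect_sym => vw.
by case: (district_union_connect dD vD vw).
Qed.

Lemma dis_eq A v w : w \in dis G A [set v] -> dis G A [set w] = dis G A [set v].
Proof.
case/disP=> wA wv; apply/setP=> u.
apply/disP/disP=> -[uA uw]; split=> //; apply: (connect_trans uw) => //.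
by rewrite bi_connect_sym.
Qed.

(** * Heads *)

Lemma head_neq0 H : is_head G H -> H != set0.
Proof. by case/and3P. Qed.

Lemma head_barren H : is_head G H -> barren G H = H.
Proof. by case/and3P=> _ /eqP. Qed.

(** Any set connected by bidirected paths through its own ancestors yields a
head: its maximal elements have the same ancestors, so they stay connected. *)
Lemma barren_head B v : v \in B -> B \subset dis G (an G B) [set v] ->
  is_head G (barren G B).
Proof.
move=> vB /subsetP h; apply/and3P; split.
- by rewrite barren_eq0; apply/set0Pn; exists v.
- by rewrite barren_id.
rewrite an_barren; apply/exists_inP; exists v; first exact: (subsetP (sub_an G B)).
by apply/subsetP=> w /barrenP[/h].
Qed.

Lemma dis_barren_head A v : v \in A -> is_head G (barren G (dis G A [set v])).
Proof.
move=> vA; apply: (@barren_head _ v); first exact: dis_self.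
set D := dis _ _ _; apply/subsetP=> w wD; have /disP[wA wv] := wD.
apply/disP; split; first exact: (subsetP (sub_an G D)).
have [wvD _] := district_union_connect (dis_district_union A v) wD wv.
exact: bi_connectS (sub_an G D) wvD.
Qed.

Lemma head_connect H u w : is_head G H -> u \in H -> w \in H ->
  connect (bi_in G (an G H)) u w.
Proof.
case/and3P=> _ _ /exists_inP[v _ /subsetP h] /h/disP[_ uv] /h/disP[_ wv].
by apply: connect_trans uv _; rewrite bi_connect_sym.
Qed.

Lemma head_in_district_union A D H u : ancestral G A -> district_union A D ->
  is_head G H -> H \subset A -> u \in H -> u \in D -> H \subset D.
Proof.
move=> aA dD hH HA uH uD; apply/subsetP=> w wH.
have := bi_connectS (ancestral_sub aA HA) (head_connect hH uH wH).
by case/(district_union_connect dD uD).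
Qed.

(** Two heads that meet are dominated by a common head; hence maximal heads of
a set are disjoint. *)
Lemma headU H1 H2 u : is_head G H1 -> is_head G H2 -> u \in H1 -> u \in H2 ->
  is_head G (barren G (H1 :|: H2)).
Proof.
move=> h1 h2 u1 u2; apply: (@barren_head _ u); first by rewrite inE u1.
apply/subsetP=> w /[dup] wU; case/setUP=> wH; apply/disP.
- split; first exact: (subsetP (sub_an _ _)).
  by apply: bi_connectS (head_connect h1 wH u1); apply/anS/subsetUl.
split; first exact: (subsetP (sub_an _ _)).
by apply: bi_connectS (head_connect h2 wH u2); apply/anS/subsetUr.
Qed.

(** * Tails *)

(** For a district [D] of an ancestral set this is the tail of the head
[barren G D]. *)
Definition district_tail D : {set V} := (D :\: barren G D) :|: pa G D.

(** A vertex that has a proper descendant in [D] keeps it in [E], so passing to a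
smaller district can only shrink the tail. *)
Lemma district_tailS D E : D \subset E -> district_tail D \subset district_tail E.
Proof.
move=> DE; apply: setUSS (paS DE); apply/subsetP=> v /setDP[vD nb].
rewrite inE (subsetP DE v vD) andbT; apply: contra nb.
exact: barrenS.
Qed.

Lemma district_tail_barren A D v : D \subset A -> v \in barren G A ->
  v \notin district_tail D.
Proof.
move=> DA vA; apply/negP=> /setUP[/setDP[vD /negP[]]|/paP[w wD vw]].
  exact: barrenS vA.
by rewrite (barren_dir vA (subsetP DA w wD)) in vw.
Qed.

Lemma dis_head H u : is_head G H -> u \in H ->
  dis G (an G H) H = dis G (an G H) [set u].
Proof.
move=> hH uH; apply/setP=> w; apply/idP/disP.
  rewrite inE => /andP[wA /exists_inP[t tH wt]]; split=> //.
  by apply: connect_trans (head_connect hH tH uH); rewrite bi_connect_sym.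
case=> wA wu; rewrite inE wA; apply/exists_inP; exists u => //.
by rewrite bi_connect_sym.
Qed.

(** The maximal elements of the district of [H] among its ancestors are [H]
itself. *)
Lemma head_tailE H : is_head G H -> head_tail G H = district_tail (dis G (an G H) H).
Proof.
move=> hH; rewrite /head_tail /district_tail; congr (_ :\: _ :|: _).
have HD : H \subset dis G (an G H) H.
  apply/subsetP=> u uH; rewrite (dis_head hH uH); apply: dis_self.
  exact: (subsetP (sub_an G H)).
rewrite -{1}(head_barren hH).
apply/setP=> v; apply/idP/idP=> vH.
  apply: (@barrenS _ (an G H)); last by rewrite barren_an.
    by apply/subsetP=> w; rewrite inE => /andP[].
  by apply: (subsetP HD); move/barrenP: vH => [].
have /barrenP[vD h] := vH; move: (vD); rewrite inE => /andP[/anP[w wH vw] _].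
by rewrite head_barren // -(h w (subsetP HD w wH) vw).
Qed.

Lemma head_tail_sub A H u : ancestral G A -> is_head G H -> H \subset A -> u \in H ->
  head_tail G H \subset district_tail (dis G A [set u]).
Proof.
move=> aA hH HA uH; rewrite head_tailE // (dis_head hH uH); apply: district_tailS.
by apply: disS (ancestral_sub aA HA) _; apply: (subsetP (sub_an G H)).
Qed.

Lemma an_dis_dis A D v : ancestral G A -> D = dis G A [set v] -> v \in A ->
  dis G (an G D) [set v] = D.
Proof.
move=> aA eD vA; have DA : D \subset A by rewrite eD dis_sub.
have vD : v \in D by rewrite eD dis_self.
apply/eqP; rewrite eqEsubset {2}eD disS ?ancestral_sub //=; last first.
  exact: (subsetP (sub_an G D)).
apply/subsetP=> w wD; apply/disP; split; first exact: (subsetP (sub_an G D)).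
move: (wD); rewrite {1}eD => /disP[_ wv].
have dD : district_union A D by rewrite eD; apply: dis_district_union.
have [cD _] := district_union_connect dD wD wv.
exact: bi_connectS (sub_an G D) cD.
Qed.

Lemma dis_head_tail A v : ancestral G A -> v \in A ->
  head_tail G (barren G (dis G A [set v])) = district_tail (dis G A [set v]).
Proof.
move=> aA vA; have hH := dis_barren_head vA; rewrite head_tailE //.
set D := dis G A [set v] in hH *; congr district_tail.
have /set0Pn[u uH] := head_neq0 hH.
rewrite (dis_head hH uH) an_barren.
have uD : u \in D by case/barrenP: uH.
have -> : D = dis G A [set u] by rewrite (dis_eq uD).
by apply: (an_dis_dis aA); rewrite // (subsetP (dis_sub A v)).
Qed.

(** * Recursive partition *)

Lemma PhiP W H :
  reflect [/\ is_head G H, H \subset W & forall H', is_head G H' -> H' \subset W ->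
             H \subset an G H' -> H = H'] (H \in Phi G W).
Proof.
rewrite inE; apply: (iffP and3P) => -[hH HW h]; split=> //.
  move=> H' hH' H'W HH'; apply/eqP/negPn/negP=> ne.
  by have /forallP/(_ H') := h; rewrite hH' H'W /prec ne HH'.
apply/forallP=> H'; apply/implyP=> /andP[hH' H'W]; apply/negP=> /andP[/eqP ne HH'].
by apply: ne; apply: h.
Qed.

Lemma PhiS W W' H : H \in Phi G W -> H \subset W' -> W' \subset W -> H \in Phi G W'.
Proof.
case/PhiP=> hH HW h HW' W'W; apply/PhiP; split=> // H' hH' H'W.
by apply: h => //; apply: subset_trans W'W.
Qed.

Lemma Phi_disjoint W H1 H2 : H1 \in Phi G W -> H2 \in Phi G W -> H1 != H2 ->
  [disjoint H1 & H2].
Proof.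
case/PhiP=> h1 W1 m1 /PhiP[h2 W2 m2]; apply: contraR => /pred0Pn[u /andP[/= u1 u2]].
have hU := headU h1 h2 u1 u2.
have UW : barren G (H1 :|: H2) \subset W.
  by apply: subset_trans (barren_sub _) _; rewrite subUset W1 W2.
rewrite (m1 _ hU UW) ?an_barren; last first.
  exact: subset_trans (subsetUl _ _) (sub_an _ _).
rewrite -(m2 _ hU UW) // an_barren.
exact: subset_trans (subsetUr _ _) (sub_an _ _).
Qed.

(** Maximal heads may be removed in any order.  Those not in [N] are disjoint
from [N], so they stay maximal in what is left, and induction there removes
them. *)
Lemma hpart_Phi W (N : {set {set V}}) : N \subset Phi G W ->
  hpart G W = N :|: hpart G (W :\: \bigcup_(H in N) H).
Proof.
have [n] := ubnP #|W|; elim: n W N => // n IH W N /ltnSE Wn NP.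
have [->|/set0Pn[H HN]] := eqVneq N set0.
  by rewrite big_set0 setD0 set0U.
set W' := W :\: _.
have [/set0Pn[v vH] HW] : H != set0 /\ H \subset W.
  by case/PhiP: (subsetP NP H HN) => /head_neq0.
have lt : (#|W'| < n)%N.
  apply: leq_trans Wn; apply: proper_card; apply/properP; split; first exact: subsetDl.
  exists v; first exact: (subsetP HW).
  by rewrite inE negb_and negbK; apply/orP; left; apply/bigcupP; exists H.
have N'P : Phi G W :\: N \subset Phi G W'.
  apply/subsetP=> M /setDP[MP MN]; apply: (PhiS MP); last exact: subsetDl.
  have [_ MW _] := PhiP _ _ MP.
  apply/subsetP=> u uM; rewrite inE (subsetP MW u uM) andbT.
  apply/bigcupP=> -[K KN uK].
  have ne : M != K by apply: contraNneq MN => ->.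
  by move: (Phi_disjoint MP (subsetP NP K KN) ne) => /pred0P/(_ u) /=; rewrite uM uK.
rewrite hpartE (IH W' _ lt N'P) setUA -{1}(setID (Phi G W) N) (setIidPr NP).
congr (_ :|: hpart G _); rewrite /psi /W' setDDl; congr (_ :\: _).
by rewrite -{1}(setID (Phi G W) N) (setIidPr NP) bigcup_setU.
Qed.

Lemma hpart1 W H : H \in Phi G W -> hpart G W = H |: hpart G (W :\: H).
Proof. by move=> HP; rewrite (@hpart_Phi W [set H]) ?sub1set // big_set1. Qed.

Lemma hpart_head W H : H \in hpart G W -> is_head G H /\ H \subset W.
Proof.
have [n] := ubnP #|W|; elim: n W => // n IH W /ltnSE Wn.
have [->|W0] := eqVneq W set0; first by rewrite hpart0 inE.
rewrite hpartE => /setUP[/PhiP[] //|/IH[]].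
  exact: leq_trans (psi_card _ W0) Wn.
by move=> hH HW; split=> //; apply: subset_trans HW (subsetDl _ _).
Qed.

(** The partition is not compatible with restriction in general: its layers
compare heads across [W1] and [W2].  Removing one maximal head at a time
avoids the layers, because a head maximal in [C] stays maximal in the half
that contains it. *)
Lemma hpart_split W W1 W2 : [disjoint W1 & W2] ->
  (forall H, is_head G H -> H \subset W -> H \subset W1 \/ H \subset W2) ->
  forall C, C \subset W -> hpart G C = hpart G (C :&: W1) :|: hpart G (C :&: W2).
Proof.
move=> dW hW C; have [n] := ubnP #|C|; elim: n C => // n IH C /ltnSE Cn CW.
have [->|C0] := eqVneq C set0; first by rewrite !set0I hpart0 setU0.
have /set0Pn[H HP] := Phi_neq0 G C0; have /PhiP[hH HC _] := HP.
have /set0Pn[v vH] := head_neq0 hH.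
have lt : (#|C :\: H| < n)%N.
  apply: leq_trans Cn; apply: proper_card; apply/properP; split; first exact: subsetDl.
  by exists v; rewrite ?(subsetP HC) // inE vH.
rewrite (hpart1 HP) (IH _ lt) ?(subset_trans (subsetDl _ _)) //.
have step (X Y : {set V}) : [disjoint X & Y] -> H \subset X ->
    hpart G (C :&: X) = H |: hpart G ((C :\: H) :&: X) /\ (C :\: H) :&: Y = C :&: Y.
  move=> dXY HX; split.
    rewrite (@hpart1 (C :&: X) H) -?setIDAC //.
    by apply: (PhiS HP); rewrite ?subsetIl // subsetI HC.
  rewrite setIDAC; apply/setDidPl.
  rewrite disjoint_sym; apply: disjointWl HX _; apply: disjointWr dXY.
  exact: subsetIr.
case: (hW H hH (subset_trans HC CW)) => HX.
  by have [-> ->] := step _ _ dW HX; rewrite setUA.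
rewrite disjoint_sym in dW.
by have [-> ->] := step _ _ dW HX; rewrite setUCA.
Qed.

Lemma hpart_dis A v : ancestral G A -> v \in A ->
  barren G (dis G A [set v]) \in hpart G A.
Proof.
move=> aA vA; set D := dis G A [set v].
have dD : district_union A D := dis_district_union A v.
rewrite (@hpart_split A D (A :\: D)) //; last first.
- move=> H hH HA; have /set0Pn[u uH] := head_neq0 hH.
  have [uD|uD] := boolP (u \in D); [left|right].
    exact: (head_in_district_union aA dD hH HA uH uD).
  apply: (head_in_district_union aA (district_unionD dD) hH HA uH).
  by rewrite inE uD (subsetP HA).
- by rewrite -setI_eq0 setIDA setDIl setDv set0I.
apply/setUP; left; rewrite (setIidPr (dis_sub A v)) hpartE; apply/setUP; left.
apply/PhiP; split; [exact: dis_barren_head|exact: barren_sub|].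
move=> H hH HD BH; apply: (head_an_inj (dis_barren_head vA) hH BH).
by rewrite an_barren; apply: subset_trans HD (sub_an _ _).
Qed.

End Heads.


(** * Outcomes *)

Section States.
Variables (V : finType).
Implicit Types (A B S : {set V}) (x y z : state V).

(** The exchange of coordinates behind both directions: it pairs outcomes in
[factor_cond_indep] and moves the irrelevant coordinates of an outcome to a
point of positive probability in [markov_district]. *)
Definition mix S x y : state V := [ffun v => if v \in S then x v else y v].

Lemma mix_in S x y : {in S, mix S x y =1 x}.
Proof. by move=> v vS; rewrite ffunE vS. Qed.

Lemma mix_out S x y v : v \notin S -> mix S x y v = y v.
Proof. by move=> /negbTE vS; rewrite ffunE vS. Qed.

Lemma evP A x y : reflect {in A, y =1 x} (y \in ev A x).
Proof. by rewrite inE; apply: (iffP forall_inP) => h v /h /eqP. Qed.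

Lemma eq_ev A x y : {in A, x =1 y} -> ev A x = ev A y.
Proof.
move=> xy; apply/setP=> z.
by apply/evP/evP=> h v vA; rewrite h // xy.
Qed.

Lemma evU A B x : ev A x :&: ev B x = ev (A :|: B) x.
Proof.
apply/setP=> z; rewrite inE; apply/andP/evP.
  by case=> /evP hA /evP hB v /setUP[/hA|/hB].
by move=> h; split; apply/evP=> v vA; apply: h; rewrite inE vA ?orbT.
Qed.

Lemma evS A B x : A \subset B -> ev B x \subset ev A x.
Proof.
by move=> /subsetP AB; apply/subsetP=> z /evP h; apply/evP=> v /AB; apply: h.
Qed.

Lemma zerosP A x v : reflect (v \in A /\ x v = false) (v \in zeros A x).
Proof.
by rewrite inE; apply: (iffP andP) => -[vA]; [move/negbTE | move->].
Qed.

Lemma zeros_sub A x : zeros A x \subset A.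
Proof. by apply/subsetP=> v /zerosP[]. Qed.

Lemma zerosI A B x : B \subset A -> zeros B x = zeros A x :&: B.
Proof.
move=> /subsetP BA; apply/setP=> v; rewrite !inE.
by have := BA v; case: (v \in B) => [->|]; rewrite ?andbT ?andbF.
Qed.

Lemma eq_zeros A x y : {in A, x =1 y} -> zeros A x = zeros A y.
Proof.
by move=> xy; apply/setP=> v; rewrite !inE; apply: andb_id2l => /xy ->.
Qed.

End States.

(** * The alternating expansion *)

Section Expansion.
Variables (R : realFieldType) (V : finType) (G : admg V).
Variable q : {set V} -> state V -> R.
Implicit Types (A C H W : {set V}) (x y : state V).

Definition expansion W x : R :=
  \sum_(C : {set V} | (zeros W x \subset C) && (C \subset W))
     (-1) ^+ #|C :\: zeros W x| * \prod_(H in hpart G C) q H x.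

Lemma expansion0 x : expansion set0 x = 1.
Proof.
have z0 : zeros set0 x = set0 by apply/eqP; rewrite -subset0 zeros_sub.
rewrite /expansion (big_pred1 set0) => [|C].
  by rewrite set0D cards0 hpart0 big_set0 mulr1.
by rewrite z0 sub0set subset0.
Qed.

Lemma eq_expansion W x y : {in W, x =1 y} ->
  (forall H, is_head G H -> H \subset W -> q H x = q H y) ->
  expansion W x = expansion W y.
Proof.
move=> xy qxy; rewrite /expansion (eq_zeros xy).
apply: eq_bigr => C /andP[_ CW]; congr (_ * _); apply: eq_bigr => H HC.
by have [hH HC'] := hpart_head HC; rewrite qxy // (subset_trans HC').
Qed.

(** Signs multiply over disjoint sets and, by [hpart_split], so do the products
over heads. *)
Lemma expansion_split W1 W2 x : [disjoint W1 & W2] ->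
  (forall H, is_head G H -> H \subset W1 :|: W2 -> H \subset W1 \/ H \subset W2) ->
  expansion (W1 :|: W2) x = expansion W1 x * expansion W2 x.
Proof.
move=> dW hW; rewrite /expansion big_distrlr /= pair_big /=.
have I1 C1 C2 : C1 \subset W1 -> C2 \subset W2 -> (C1 :|: C2) :&: W1 = C1.
  move=> s1 s2; rewrite setIUl (setIidPl s1); apply/setUidPl.
  have /eqP -> : C2 :&: W1 == set0; last exact: sub0set.
  by rewrite setI_eq0; apply: disjointWl s2 _; rewrite disjoint_sym.
have I2 C1 C2 : C1 \subset W1 -> C2 \subset W2 -> (C1 :|: C2) :&: W2 = C2.
  move=> s1 s2; rewrite setIUl (setIidPl s2); apply/setUidPr.
  have /eqP -> : C1 :&: W2 == set0; last exact: sub0set.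
  by rewrite setI_eq0; apply: disjointWl s1 _.
have z1 : zeros W1 x = zeros (W1 :|: W2) x :&: W1 by apply/zerosI/subsetUl.
have z2 : zeros W2 x = zeros (W1 :|: W2) x :&: W2 by apply/zerosI/subsetUr.
have z12 : zeros (W1 :|: W2) x = zeros W1 x :|: zeros W2 x.
  by rewrite z1 z2 -setIUr; apply/esym/setIidPl/zeros_sub.
rewrite (reindex_onto (fun p => p.1 :|: p.2) (fun C => (C :&: W1, C :&: W2))) /=;
  last by move=> C /andP[_ CW]; rewrite -setIUr; apply/setIidPl.
have cond C1 C2 : (zeros (W1 :|: W2) x \subset C1 :|: C2) &&
    (C1 :|: C2 \subset W1 :|: W2) &&
    (((C1 :|: C2) :&: W1, (C1 :|: C2) :&: W2) == (C1, C2)) =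
  (zeros W1 x \subset C1) && (C1 \subset W1) &&
    ((zeros W2 x \subset C2) && (C2 \subset W2)).
  apply/andP/andP=> -[/andP[a b]].
    rewrite xpair_eqE => /andP[/eqP e1 /eqP e2].
    have [s1 s2] : C1 \subset W1 /\ C2 \subset W2.
      by split; [rewrite -e1|rewrite -e2]; apply: subsetIr.
    by rewrite s1 s2 z1 z2 !andbT; split; [rewrite -e1|rewrite -e2]; apply: setSI.
  case/andP=> c d; rewrite z12 !setUSS //= xpair_eqE.
  by rewrite (I1 C1 C2) // (I2 C1 C2) // !eqxx.
apply: eq_big => [[C1 C2]|[C1 C2]] /=; first exact: cond.
rewrite cond => /andP[/andP[a s1] /andP[b s2]].
rewrite mulrACA -exprD; congr (_ ^+ _ * _).
  rewrite !cardsDS // ?z12 ?setUSS // !cardsU.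
  have /eqP -> : C1 :&: C2 == set0.
    by rewrite setI_eq0; apply: disjointWl s1 _; apply: disjointWr s2 _.
  have /eqP -> : zeros W1 x :&: zeros W2 x == set0.
    rewrite setI_eq0; apply: disjointWl (zeros_sub _ _) _.
    exact: disjointWr (zeros_sub _ _) _.
  by have := subset_leq_card a; have := subset_leq_card b; rewrite cards0; lia.
rewrite (hpart_split dW hW (setUSS s1 s2)) (I1 C1 C2) // (I2 C1 C2) //.
rewrite -bigU; first by apply: eq_bigl => H; rewrite !inE.
rewrite disjoint_subset; apply/subsetP=> H /hpart_head[hH H1].
apply/negP=> /hpart_head[_ H2]; have /set0Pn[v vH] := head_neq0 hH.
move/pred0P/(_ v): dW; rewrite /= (subsetP s1) ?(subsetP H1) //.
by rewrite (subsetP s2) ?(subsetP H2).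
Qed.

(** The zeros of [x] contain [H], so every [C] of the sum does, and [H] is then a
block of each partition. *)
Lemma expansion_head A H x : H != set0 -> H \subset zeros A x ->
  (forall C, H \subset C -> C \subset A -> H \in Phi G C) ->
  expansion A x = q H x * expansion (A :\: H) x.
Proof.
move=> H0 Hz HPhi; rewrite /expansion mulr_sumr.
have HA : H \subset A := subset_trans Hz (zeros_sub _ _).
have zD : zeros (A :\: H) x = zeros A x :\: H.
  by rewrite (@zerosI _ A) ?subsetDl // setIDA (setIidPl (zeros_sub _ _)).
rewrite (reindex_onto (fun C => H :|: C) (fun C => C :\: H)) /=; last first.
  move=> C /andP[zC _]; rewrite -[X in X :|: _](setIidPr (subset_trans Hz zC)).
  exact: setID.
have cond C : (zeros A x \subset H :|: C) && (H :|: C \subset A) &&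
    ((H :|: C) :\: H == C) =
  (zeros (A :\: H) x \subset C) && (C \subset A :\: H).
  rewrite setDUl setDv set0U zD subDset -andbA subUset HA subsetD; congr (_ && (_ && _)).
  by apply/eqP/idP=> /setDidPl.
apply: eq_big => C; first exact: cond.
rewrite cond zD => /andP[zC CA].
have dC : [disjoint C & H] by move: CA; rewrite subsetD => /andP[].
have CD : (H :|: C) :\: H = C by rewrite setDUl setDv set0U; apply/setDidPl.
have HC : H \in Phi G (H :|: C).
  apply: HPhi; rewrite ?subsetUl // subUset HA.
  exact: subset_trans CA (subsetDl _ _).
rewrite (hpart1 HC) CD big_setU1 /=; last first.
  apply/negP=> /hpart_head[_ HC']; move: H0; rewrite -subset0.
  by rewrite -(eqP (etrans (setI_eq0 C H) dC)) subsetI HC' subxx.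
rewrite mulrCA; congr (_ * (_ ^+ _ * _)).
congr #|pred_of_set _|; apply/setP=> v; rewrite !inE.
have := subsetP Hz v; rewrite inE; case vH: (v \in H) => /=; last by [].
by move=> -> //=; rewrite (disjointFl dC).
Qed.

(** Split the sum according to whether [C] contains [w]: this mirrors
P(X_w = 1) = 1 - P(X_w = 0). *)
Lemma expansion_one A w x x' : w \in A -> x w -> ~~ x' w ->
  (forall v, v != w -> x' v = x v) ->
  (forall H, is_head G H -> H \subset A -> q H x' = q H x) ->
  expansion A x = expansion (A :\ w) x - expansion A x'.
Proof.
move=> wA xw xw' xx' qx; rewrite /expansion (bigID (fun C : {set V} => w \in C)) /= addrC.
have z0 : zeros (A :\ w) x = zeros A x.
  apply/setP=> v; rewrite !inE; case: eqP => //= ->; by rewrite wA xw.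
have z1 : zeros A x' = w |: zeros A x.
  apply/setP=> v; rewrite !inE; case: eqP => [->|/eqP /xx' ->] //=.
  by rewrite wA xw'.
rewrite -sumrN z0; congr (_ + _); apply: eq_big => C //.
- by rewrite subsetD1 andbA.
- by rewrite z1 subUset sub1set; case: (w \in C); rewrite ?andbT ?andbF.
move=> /andP[/andP[zC CA] wC]; rewrite -mulNr z1; congr (_ * _).
  rewrite setUC -setDDl (cardsD1 w (C :\: _)) inE wC inE xw /= andbF.
  by rewrite exprS mulN1r.
apply: eq_bigr => H /hpart_head[hH HC]; rewrite qx //.
exact: subset_trans CA.
Qed.

End Expansion.


(** * Events and conditional independence *)

Section Probability.
Variables (R : realFieldType) (V : finType) (P : state V -> R).
Hypothesis HP : is_prob P.
Implicit Types (A B C S W : {set V}) (E F : {set state V}) (x y z : state V).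

Lemma pr_ge0 E : 0 <= pr P E.
Proof. by apply: sumr_ge0 => x _; case: HP. Qed.

Lemma pr_mono E F : E \subset F -> pr P E <= pr P F.
Proof.
move=> EF; rewrite /pr [leRHS](big_setID E) /= (setIidPr EF) lerDl.
exact: pr_ge0.
Qed.

Lemma pr_evS A B x : A \subset B -> pr P (ev B x) <= pr P (ev A x).
Proof. by move=> AB; apply/pr_mono/evS. Qed.

Lemma pr_ev_gt0 A y : 0 < P y -> 0 < pr P (ev A y).
Proof.
move=> y0; apply: lt_le_trans (_ : pr P [set y] <= _); first by rewrite /pr big_set1.
by apply: pr_mono; rewrite sub1set; apply/evP.
Qed.

Lemma pr_gt0P E : 0 < pr P E -> exists2 y, y \in E & 0 < P y.
Proof.
move=> E0.
have [|y /andP[yE y0]] := @psumr_neq0P _ _ (fun y => y \in E) P (fun y _ => HP.1 y).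
  by apply/eqP; rewrite gt_eqF.
by exists y.
Qed.

Lemma pr_ev_set0 x : pr P (ev set0 x) = 1.
Proof.
rewrite -HP.2; apply: eq_bigl => y; apply/evP => v; by rewrite inE.
Qed.

Lemma pr_evD1 A w x x' : w \in A -> x' w = ~~ x w ->
  (forall v, v != w -> x' v = x v) ->
  pr P (ev (A :\ w) x) = pr P (ev A x) + pr P (ev A x').
Proof.
move=> wA xw xx'; rewrite /pr (bigID (fun y : state V => y w == x w)) /=.
congr (_ + _); apply: eq_bigl => y.
  apply/andP/evP=> [[/evP h /eqP yw] v vA|h].
    by have [->//|vw] := eqVneq v w; apply: h; rewrite !inE vw.
  by split; [apply/evP=> v /setD1P[_]|rewrite h]; rewrite //; apply: h.
apply/andP/evP=> [[/evP h yw] v vA|h].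
  have [->|vw] := eqVneq v w; last by rewrite xx' //; apply: h; rewrite !inE vw.
  by rewrite xw; case: (y w) (x w) yw => -[].
split; last by rewrite h // xw; case: (x w).
by apply/evP=> v /setD1P[vw vA]; rewrite h // xx'.
Qed.

(** The division-free form also covers the null outcomes of [C], where both
sides vanish. *)
Lemma cond_indepP A B C : cond_indep P A B C <->
  forall x, pr P (ev (A :|: B :|: C) x) * pr P (ev C x) =
            pr P (ev (A :|: C) x) * pr P (ev (B :|: C) x).
Proof.
rewrite /cond_indep /cpr; split=> h x; last first.
  move=> C0; have Cn : pr P (ev C x) != 0 by rewrite gt_eqF.
  apply: (mulIf Cn); rewrite !evU divfK //; apply: (mulIf Cn); rewrite h.
  by field.
have [C0|] := ltP 0 (pr P (ev C x)).
  have Cn : pr P (ev C x) != 0 by rewrite gt_eqF.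
  have := h x C0; rewrite !evU => /(congr1 (fun t => t * (pr P (ev C x) * pr P (ev C x)))).
  by rewrite mulrA divfK // => ->; field.
move=> C0; have e : pr P (ev C x) = 0 by apply: le_anti; rewrite C0 pr_ge0.
have -> : pr P (ev (A :|: C) x) = 0.
  by apply: le_anti; rewrite pr_ge0 andbT -e pr_evS ?subsetUr.
by rewrite e mulr0 mul0r.
Qed.

(** Each outcome on [A] is represented by its extension by [x]. *)
Lemma pr_ev_partition A W x : W \subset A ->
  pr P (ev W x) = \sum_(z in ev (W :|: ~: A) x) pr P (ev A z).
Proof.
move=> /subsetP WA; rewrite /pr.
rewrite (partition_big (fun z => mix A z x) (mem (ev (W :|: ~: A) x))) /=; last first.
  move=> z /evP h; apply/evP=> v; rewrite ffunE !inE => /orP[vW|/negbTE -> //].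
  by rewrite WA // h.
apply: eq_bigr => y /evP hy; apply: eq_bigl => z.
apply/andP/evP=> [[_ /eqP <-] v vA|h]; first by rewrite mix_in.
split; first by apply/evP=> v vW; rewrite h ?WA // hy // inE vW.
apply/eqP/ffunP=> v; rewrite ffunE; case: ifPn => [/h //|vA].
by rewrite hy // !inE vA orbT.
Qed.

(** Write both sides as sums over pairs of outcomes of [A0].  Exchanging the
coordinates in [S] of the two outcomes is an involution that turns one index
set into the other and preserves the product of their probabilities, since
these factor through [f] and [g]. *)
Lemma factor_cond_indep A0 S A B C (f g : state V -> R) :
  (forall x y, {in S :|: C, x =1 y} -> f x = f y) ->
  (forall x y, {in ~: S, x =1 y} -> g x = g y) ->
  (forall x, pr P (ev A0 x) = f x * g x) ->
  A \subset S -> [disjoint B & S] -> [disjoint C & S] ->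
  A :|: B :|: C \subset A0 -> cond_indep P A B C.
Proof.
move=> hf hg fac /subsetP AS BS CS sA0; apply/cond_indepP=> x.
have [sAC sBC sC] : [/\ A :|: C \subset A0, B :|: C \subset A0 & C \subset A0].
  move: sA0; rewrite !subUset => /andP[/andP[-> ->] ->]; by split.
rewrite !(@pr_ev_partition A0) // !big_distrlr /= !pair_big /=.
pose h (p : state V * state V) := (mix S p.1 p.2, mix S p.2 p.1).
have hK : involutive h.
  by case=> p1 p2; congr (_, _); apply/ffunP=> v; rewrite !ffunE; case: (v \in S).
rewrite (reindex_inj (inv_inj hK)) /=; apply: eq_big => [[p1 p2]|[p1 p2]] /=.
  have aux v : [/\ v \in A -> v \in S, v \in B -> v \in S = false
                & v \in C -> v \in S = false].
    by split; [exact: AS|exact: (disjointFr BS)|exact: (disjointFr CS)].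
  apply/andP/andP=> -[/evP a /evP b]; split; apply/evP=> v;
    move: (a v) (b v) (aux v); rewrite !ffunE !inE => {}a {}b [];
    case: (v \in A) a b; case: (v \in B); case: (v \in C); case: (v \in S);
    case: (v \in A0) => //= a b h1 h2 h3 _;
    by [apply: a | apply: b | have := h1 isT | have := h2 isT | have := h3 isT].
case/andP=> /evP a /evP b; rewrite !fac.
have e v : v \in C -> p1 v = p2 v.
  move=> vC; have vS := disjointFr CS vC.
  move: (a v) (b v); rewrite !ffunE !inE vC vS !orbT => a' b'.
  by rewrite a' // b'.
have -> : f (mix S p1 p2) = f p1.
  by apply: hf => v /setUP[vS|vC]; rewrite ffunE ?vS // (disjointFr CS vC) e.
have -> : f (mix S p2 p1) = f p2.
  by apply: hf => v /setUP[vS|vC]; rewrite ffunE ?vS // (disjointFr CS vC) e.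
have -> : g (mix S p1 p2) = g p2.
  by apply: hg => v; rewrite inE ffunE => /negbTE ->.
have -> : g (mix S p2 p1) = g p1.
  by apply: hg => v; rewrite inE ffunE => /negbTE ->.
by ring.
Qed.

End Probability.


(** * Unblocked walks *)

Section Walks.
Variables (V : finType) (G : admg V).
Implicit Types (a b u v w : V) (A B C D S : {set V}) (h : bool) (o : orient).
Implicit Types (p : seq (orient * V)).

(** The condition for a walk to pass through [v], when it has arrived with an
arrowhead at [v] (if [h]) and leaves with an arrowhead at [v] (if [s]). *)
Definition can_exit C v h (s : bool) : bool :=
  if h && s then v \in an G C else v \notin C.

(** Unblocked walks, which may repeat vertices.  The flag [h] records how the
walk has arrived at [v]; a walk starts with [h = false], as its first vertex
is not a collider. *)
Fixpoint open_walk C h v p : bool :=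
  if p is (o, w) :: p' then
    [&& edge G o v w, can_exit C v h (arrow_at_source o)
      & open_walk C (arrow_at_target o) w p']
  else true.

Definition walk_end v p : V := last v (map snd p).
Definition walk_arrow h p : bool := last h (map (fun s => arrow_at_target s.1) p).

Lemma open_walk_blocked C o v p :
  open_walk C (arrow_at_target o) v p = mwalk G v p && ~~ blocked G C ((o, v) :: p).
Proof.
elim: p o v => // -[o' w] p IH o v /=; rewrite IH /= negb_or /can_exit /collider.
case: (edge G o' v w) => //=; case: ifP => _; rewrite ?negbK;
  by case: (mwalk G w p) (v \in _) => -[].
Qed.

Lemma open_walkE C a p : a \notin C ->
  open_walk C false a p = mwalk G a p && ~~ blocked G C p.
Proof.
move=> aC; case: p => // -[o w] p. rewrite [LHS]/= open_walk_blocked /can_exit aC /=.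
by rewrite andbA.
Qed.

Lemma open_walk_cat C h v p1 p2 : open_walk C h v (p1 ++ p2) =
  open_walk C h v p1 && open_walk C (walk_arrow h p1) (walk_end v p1) p2.
Proof. by elim: p1 h v => // -[o w] p1 IH h v /=; rewrite IH !andbA. Qed.

(** The walk arrives with an arrowhead and ends without one.  If it leaves [v]
along a directed edge, it descends until it first meets a collider, and that
collider is an ancestor of [C]. *)
Lemma open_walk_turn C v p : open_walk C true v p -> ~~ walk_arrow true p ->
  v \in an G C.
Proof.
elim: p v => // -[o w] p IH v /= /and3P[e ex op] na.
rewrite /can_exit /= in ex; case: o e ex op na => //= vw _ op na.
exact: an_connect (IH w op na) (connect1 vw).
Qed.

(** Removing the loop [p1] at [u] may turn [u] into a collider although it is not
one at either visit; [open_walk_turn] applied to the loop then shows that [u] is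
an ancestor of [C]. *)
Lemma open_walk_cut C h u p1 p2 : p1 <> [::] -> walk_end u p1 = u ->
  open_walk C h u (p1 ++ p2) -> open_walk C h u p2.
Proof.
move=> p10 e; rewrite open_walk_cat e => /andP[op1].
case: p2 => // -[o w] p2 /= /and3P[-> ex ->]; rewrite andbT /=.
case: p1 p10 op1 e ex => // -[o' w'] p1 _ op1 e; have := op1 => /= /and3P[e1].
rewrite /can_exit; case: (arrow_at_source o); rewrite ?andbF ?andbT //.
case: h op1 => op1; last by move=> ? _ _.
case ea: (walk_arrow _ _) => //= ex1 _ uC.
apply: (@open_walk_turn C u ((o', w') :: p1)) => //.
by rewrite /walk_arrow /= in ea *; rewrite ea.
Qed.

Lemma walk_through a b p : a \in map snd p ->
  exists p1 p2, [/\ p = p1 ++ p2, p1 <> [::] & walk_end b p1 = a].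
Proof.
elim: p b => // -[o w] p IH b; rewrite inE.
have [<- _|_ /(IH w)[p1 [p2 [-> p10 e]]]] := eqVneq a w.
  by exists [:: (o, a)], p.
by exists ((o, w) :: p1), p2.
Qed.

Lemma not_uniq_walk a p : ~~ uniq (a :: map snd p) ->
  exists p1 p2 p3, [/\ p = p1 ++ p2 ++ p3, p2 <> [::]
                     & walk_end (walk_end a p1) p2 = walk_end a p1].
Proof.
elim: p a => // -[o w] p IH a; rewrite cons_uniq negb_and negbK => /orP[|/IH].
  by case/(walk_through a)=> p1 [p2 [-> p10 e]]; exists [::], p1, p2.
case=> p1 [p2 [p3 [-> p20 e]]].
by exists ((o, w) :: p1), p2, p3.
Qed.

Lemma open_walk_uniq C a p : open_walk C false a p ->
  exists q, [/\ open_walk C false a q, walk_end a q = walk_end a p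
              & uniq (a :: map snd q)].
Proof.
have [n] := ubnP (size p); elim: n p => // n IH p /ltnSE pn op.
have [u|] := boolP (uniq (a :: map snd p)); first by exists p.
case/not_uniq_walk=> p1 [p2 [p3 [ep p20 e]]].
have [||q [oq eq uq]] := IH (p1 ++ p3).
- by apply: leq_trans pn; rewrite ep !size_cat; case: p2 p20 {e ep} => //= *; lia.
- move: op; rewrite ep !open_walk_cat => /andP[-> /=].
  by rewrite -open_walk_cat; apply: open_walk_cut.
exists q; split=> //; rewrite eq ep /walk_end !map_cat !last_cat.
by move: e; rewrite /walk_end => ->.
Qed.

Lemma m_separated_open A B C a p : m_separated G A B C -> a \in A -> a \notin C ->
  open_walk C false a p -> walk_end a p \notin B.
Proof.
move=> sep aA aC /open_walk_uniq[q [oq <- uq]]; apply/negP=> bB.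
move: oq; rewrite open_walkE // => /andP[mq /negP[]].
by apply: (sep a _ q aA bB) => //; rewrite /mpath mq uq.
Qed.

(** No vertex outside [A] is an ancestor of [C], so none can be passed as a
collider: the walk can only descend, and it never enters [A], as [A] is
ancestral. *)
Lemma open_walk_outside A C v p : ancestral G A -> C \subset A -> v \notin A ->
  open_walk C true v p -> walk_end v p \notin A.
Proof.
move=> aA CA; elim: p v => //= -[o w] p IH v vA /and3P[vw ex op].
rewrite /walk_end /=; apply: IH.
  apply: contra vA; case: o vw ex {op} => /= vw; rewrite /can_exit /=.
  - by move=> _ /(ancestral_dir aA); apply.
  - by move/(subsetP (ancestral_sub aA CA)).
  by move/(subsetP (ancestral_sub aA CA)).
by case: o vw ex op => //= vw /(subsetP (ancestral_sub aA CA)); rewrite (negbTE vA).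
Qed.

(** Inside [A], each vertex of the district must be a collider, except those in
[B], which have no child in [A]; so the walk follows bidirected edges in [D]
until it ends or steps to a parent of [D], where it must stop. *)
Lemma open_walk_district A D B h v p : ancestral G A -> district_union G A D ->
  B \subset barren G A -> v \in D ->
  open_walk ((D :|: pa G D) :\: B) h v p -> walk_end v p \in A ->
  walk_end v p \in D :|: pa G D.
Proof.
move=> aA dD BA; set C := _ :\: B.
have [DA _] := dD; have pA := pa_sub aA DA.
have CA : C \subset A by apply: subset_trans (subsetDl _ _) _; rewrite subUset DA.
elim: p h v => [|[o w] p IH] h v vD; first by rewrite inE vD.
move=> /= /and3P[vw ex op]; rewrite {1 2}/walk_end /= -/(walk_end w p) => eA.
have out : arrow_at_target o -> w \in A.
  move=> ot; apply: contraLR eA => wA; rewrite ot in op.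
  exact: open_walk_outside aA CA wA op.
case: o vw ex op out => /= vw ex op out.
- have vB : v \in B.
    move: ex; by rewrite /can_exit andbF in_setD in_setU vD /= andbT negbK.
  by move: vw; rewrite (barren_dir (subsetP BA v vB) (out isT)).
- have wP : w \in pa G D by apply/paP; exists v.
  case: p op eA {IH} => [|[o' w'] p] /=; first by move=> _ _; apply/setUP; right.
  case/and3P=> _; rewrite /can_exit /= in_setD in_setU wP orbT andbT negbK => wB.
  by move: vw; rewrite (barren_dir (subsetP BA w wB)) // (subsetP DA).
apply: (IH true w) => //; case: dD => _ /(_ v w vD (out isT)); exact.
Qed.

Lemma m_separated_district A D B : ancestral G A -> district_union G A D ->
  B \subset barren G A -> B \subset D ->
  m_separated G B (A :\: (D :|: pa G D)) ((D :|: pa G D) :\: B).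
Proof.
move=> aA dD BA BD a b p aB /setDP[bA bK] /andP[mp up] e.
apply: contraT => nb; have : walk_end a p \in D :|: pa G D.
  apply: (open_walk_district aA dD BA (subsetP BD a aB) (h := false)).
    by rewrite open_walkE ?mp // inE aB.
  by rewrite /walk_end e.
by rewrite /walk_end e (negbTE bK).
Qed.

(** The ordered local Markov property for a set [B] of maximal vertices. *)
Lemma district_markov (R : realFieldType) (P : state V -> R) A D B x :
  is_prob P -> global_markov G P -> ancestral G A -> district_union G A D ->
  B \subset barren G A -> B \subset D -> B != set0 ->
  pr P (ev A x) * pr P (ev ((D :|: pa G D) :\: B) x) =
  pr P (ev (D :|: pa G D) x) * pr P (ev (A :\: B) x).
Proof.
move=> HP gm aA dD BA BD B0; set K := D :|: pa G D.
have KA : K \subset A by case: dD => DA _; rewrite subUset DA pa_sub.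
have BK : B \subset K := subset_trans BD (subsetUl _ _).
have [/eqP|R0] := eqVneq (A :\: K) set0.
  by rewrite setD_eq0 => AK; have -> : A = K by apply/eqP; rewrite eqEsubset AK.
have eB : B :|: (K :\: B) = K by rewrite -{1}(setIidPr BK) setID.
have eK : K :|: (A :\: K) = A by rewrite -{1}(setIidPr KA) setID.
have := m_separated_district aA dD BA BD; rewrite -/K => sep.
have dis (X Y Z : {set V}) : X \subset Z -> Y \subset ~: Z -> [disjoint X & Y].
  move=> XZ YZ; rewrite disjoint_sym disjoints_subset.
  by apply: subset_trans YZ _; rewrite setCS.
have /(cond_indepP HP)/(_ x) : cond_indep P B (A :\: K) (K :\: B).
  apply: gm => //.
  - by apply: (dis _ _ K) => //; rewrite setDE subsetIr.
  - by apply: (dis _ _ B) => //; rewrite setDE subsetIr.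
  - rewrite disjoint_sym; apply: (dis _ _ K); first exact: subsetDl.
    by rewrite setDE subsetIr.
rewrite setUAC eB eK => ->; congr (_ * pr P (ev _ x)).
apply/setP=> v; rewrite in_setU !in_setD.
have := subsetP KA v; have := subsetP BK v.
case: (v \in B) => [/(_ isT) -> //|_].
by case: (v \in K) => [/(_ isT) ->|_] //=; rewrite orbF.
Qed.

End Walks.


(** * Reachability and separating sets *)

Section Reach.
Variables (V : finType) (G : admg V) (A B C : {set V}).
Implicit Types (u v w a b : V) (h : bool).

(** Reachability by unblocked walks is connectivity of the graph of states:
a vertex and whether the walk arrived with an arrowhead. *)
Definition walk_step : rel (V * bool) := fun s t =>
  if t.2 then
    (dir G s.1 t.1 && can_exit G C s.1 s.2 false) ||
    (bi G s.1 t.1 && can_exit G C s.1 s.2 true)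
  else dir G t.1 s.1 && can_exit G C s.1 s.2 true.

Definition reach v h : bool := [exists a in A, connect walk_step (a, false) (v, h)].

Lemma reach_start a : a \in A -> reach a false.
Proof. by move=> aA; apply/exists_inP; exists a. Qed.

Lemma reach_step v h w h' : reach v h -> walk_step (v, h) (w, h') -> reach w h'.
Proof.
case/exists_inP=> a aA av s; apply/exists_inP; exists a => //.
exact: connect_trans av (connect1 s).
Qed.

Lemma walk_step_open s t : connect walk_step s t ->
  exists2 p, open_walk G C s.2 s.1 p & walk_end s.1 p = t.1.
Proof.
case/connectP=> q; elim: q s => [|[w h'] q IH] [v h] /=.
  by move=> _ e; exists [::]; rewrite ?e.
case/andP=> st qp /(IH (w, h') qp)[p /= op e].
case: h' st op {qp} => [/orP[]|] /andP[vw ex] op.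
- by exists ((Fwd, w) :: p); rewrite //= vw ex.
- by exists ((Bid, w) :: p); rewrite //= vw ex.
by exists ((Bwd, w) :: p); rewrite //= vw ex.
Qed.

Hypotheses (AC : [disjoint A & C])
  (sep : m_separated G A B C).

Lemma reach_notin v h : reach v h -> v \notin B.
Proof.
case/exists_inP=> a aA /walk_step_open[p op /= <-].
by apply: (m_separated_open sep aA _ op); rewrite (disjointFr AC).
Qed.

(** Below a vertex that is not an ancestor of [C] there is no vertex of [C] to
block a directed path. *)
Lemma reach_down v h w : reach v h -> v \notin an G C -> connect (dir G) v w ->
  exists h', reach w h'.
Proof.
move=> rv nC /connectP[p]; elim: p v h rv nC => [|u p IH] v h rv nC /=.
  by move=> _ ->; exists h.
case/andP=> vu; apply: (IH u true).
  apply: (reach_step rv); rewrite /walk_step /= vu /can_exit andbF /=.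
  by rewrite (contra (subsetP (sub_an G C) v)).
by apply: contra nC => uC; apply: an_connect uC (connect1 vu).
Qed.

(** Start again at [w] and follow the directed path backwards. *)
Lemma reach_up v w : w \in A -> v \notin an G C -> connect (dir G) v w ->
  reach v false.
Proof.
move=> wA nC /connectP[p]; elim: p v nC => [|u p IH] v nC /=.
  by move=> _ <-; apply: reach_start.
case/andP=> vu pu e.
have nu : u \notin an G C.
  by apply: contra nC => uC; apply: an_connect uC (connect1 vu).
apply: (reach_step (IH u nu pu e)); rewrite /walk_step /= vu /can_exit /=.
by rewrite (contra (subsetP (sub_an G C) u)).
Qed.

Let A0 := an G (A :|: B :|: C).

(** A walk from [A] can go on from [v] along any edge with an arrowhead at
[v]. *)
Definition exits v : bool := [exists h, reach v h && can_exit G C v h true].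

(** An ancestor of [C] can serve as a collider.  Otherwise, if [v] is an ancestor
of [A], a walk that starts below [v] goes through it as a non-collider; and [v]
is no ancestor of [B], which could then be reached. *)
Lemma reach_exits v h : reach v h -> v \in A0 -> h || (v \notin C) -> exits v.
Proof.
move=> rv vA0 hv; have [vC|vC] := boolP (v \in an G C).
  apply/existsP; exists h; rewrite rv /can_exit vC; case: h hv {rv} => //=.
have vnC : v \notin C by apply: contra vC; apply: (subsetP (sub_an G C)).
case/anP: vA0 => w /setUP[/setUP[wA|wB]|wC] vw.
- by apply/existsP; exists false; rewrite (reach_up wA vC vw) /can_exit.
- by have [h' /reach_notin] := reach_down rv vC vw; rewrite wB.
by case/negP: vC; apply/anP; exists w.
Qed.

Lemma exits_bi v w : exits v -> bi G v w -> w \in A0 -> exits w.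
Proof.
case/existsP=> h /andP[rv ex] vw wA0; apply: (reach_exits (h := true)) => //.
by apply: (reach_step rv); rewrite /walk_step /= vw ex orbT.
Qed.

Lemma exits_bi_connect v w : exits v -> connect (bi_in G A0) v w -> exits w.
Proof.
move=> ev /connectP[p]; elim: p v ev => [|u p IH] v ev /=; first by move=> _ ->.
case/andP=> /and3P[_ uA0 vu]; apply: IH.
exact: exits_bi ev vu uA0.
Qed.

Definition reach_set : {set V} :=
  [set v in A0 | (v \notin C) && (reach v false || reach v true)].

Lemma reach_setP v : reflect [/\ v \in A0, v \notin C & exists h, reach v h]
  (v \in reach_set).
Proof.
apply: (iffP setIdP) => [[vA0 /andP[vC /orP r]]|[vA0 vC [h r]]]; split=> //.
  by case: r => r; [exists false|exists true].
by rewrite vC; case: h r => ->; rewrite ?orbT.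
Qed.

Lemma reach_set_sub : A \subset reach_set.
Proof.
apply/subsetP=> a aA; apply/reach_setP; split.
- by apply: (subsetP (sub_an _ _)); rewrite !inE aA.
- by rewrite (disjointFr AC).
by exists false; apply: reach_start.
Qed.

Lemma reach_set_disjoint : [disjoint B & reach_set].
Proof.
apply/pred0P=> v /=; apply/negP=> /andP[vB /reach_setP[_ _ [h /reach_notin]]].
by rewrite vB.
Qed.

Lemma reach_set_given : [disjoint C & reach_set].
Proof. by apply/pred0P=> v /=; apply/negP=> /andP[vC /reach_setP[_ /negP]]. Qed.

(** From any vertex of the set that lies in the district or among its parents,
a walk enters the district, follows bidirected edges to all of it
([reach_exits] takes care of the colliders), and goes up to any parent. *)
Lemma reach_set_closed v : v \in A0 ->
  let K := dis G A0 [set v] :|: pa G (dis G A0 [set v]) in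
  ~~ [disjoint K & reach_set] -> K \subset reach_set :|: C.
Proof.
move=> vA0; set D := dis G A0 [set v] => K /pred0Pn[u /andP[/= uK uS]].
have DA0 : D \subset A0 := dis_sub G A0 v.
have PA0 : pa G D \subset A0 by apply: pa_sub DA0; apply: an_ancestral.
have {uS} [uA0 uC [h ru]] := reach_setP _ uS.
have [w wD ew] : exists2 w, w \in D & exits w.
  case/setUP: uK => [uD|/paP[w wD uw]].
    by exists u => //; apply: (reach_exits ru) => //; rewrite uC orbT.
  exists w => //; apply: (@reach_exits w true) => //; last exact: (subsetP DA0).
  by apply: (reach_step ru); rewrite /walk_step /= uw /can_exit andbF uC.
have eD t : t \in D -> exits t.
  move=> tD; apply: (exits_bi_connect ew).
  case/disP: wD => _ wv; case/disP: tD => _ tv.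
  by apply: (connect_trans wv); rewrite bi_connect_sym.
apply/subsetP=> t /setUP[tD|tP]; rewrite in_setU; case tC: (t \in C);
  rewrite ?orbT // orbF; apply/reach_setP; rewrite tC; split=> //.
- exact: (subsetP DA0).
- by case/existsP: (eD t tD) => h' /andP[]; exists h'.
- exact: (subsetP PA0).
case/paP: tP => s sD ts; exists false; case/existsP: (eD s sD) => h' /andP[rs ex].
by apply: (reach_step rs); rewrite /walk_step /= ts ex.
Qed.

End Reach.


(** * From the Markov property to the expansion *)

Section Forward.
Variables (R : realFieldType) (V : finType) (G : admg V) (P : state V -> R).
Variable q : {set V} -> state V -> R.
Hypothesis HP : is_prob P.
Hypothesis Hq : forall H : {set V}, is_head G H ->
  cond_version P (ev0 H) (head_tail G H) (q H).
Implicit Types (A B C D H : {set V}) (x y z : state V).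

(** [expansion_defined] in terms of districts, a form inherited by ancestral
subsets. *)
Definition tails_positive A x : Prop :=
  forall v, v \in A -> 0 < pr P (ev (district_tail G (dis G A [set v])) x).

Lemma district_tail_sub A D :
  ancestral G A -> D \subset A -> district_tail G D \subset A.
Proof.
move=> aA DA; rewrite subUset pa_sub // andbT.
exact: subset_trans (subsetDl _ _) DA.
Qed.

Lemma tails_positiveS A B x : B \subset A -> tails_positive A x -> tails_positive B x.
Proof.
move=> BA tp v vB; apply: lt_le_trans (tp v (subsetP BA v vB)) _.
by apply/pr_evS/district_tailS/disS.
Qed.

Lemma tails_positive_barren A x y :
  (forall v, v \notin barren G A -> x v = y v) ->
  tails_positive A x -> tails_positive A y.
Proof.
move=> xy tp v vA; have := tp v vA; rewrite (@eq_ev _ _ x y) // => u uT.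
apply: xy; apply: contraL uT; apply: district_tail_barren; exact: dis_sub.
Qed.

(** The heads of the districts of [A] occur in the term [C = A]; conversely the
tail of any head in [A] lies in the tail of its district. *)
Lemma expansion_definedE A x : ancestral G A ->
  expansion_defined G P A x <-> tails_positive A x.
Proof.
move=> aA; split=> h.
  move=> v vA; rewrite -dis_head_tail //.
  by apply: (h A); rewrite ?zeros_sub //; apply: hpart_dis.
move=> C H _ CA /hpart_head[hH HC]; have HA := subset_trans HC CA.
have /set0Pn[u uH] := head_neq0 hH.
apply: lt_le_trans (h u (subsetP HA u uH)) _; apply: pr_evS => //.
exact: head_tail_sub.
Qed.

Lemma expansion_district A D x : ancestral G A -> district_union G A D ->
  expansion G q A x = expansion G q D x * expansion G q (A :\: D) x.
Proof.
move=> aA dD; have [DA _] := dD.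
have eA : D :|: (A :\: D) = A by rewrite -{1}(setIidPr DA) setID.
rewrite -{1}eA; apply: expansion_split.
  by rewrite -setI_eq0 setIDA setDIl setDv set0I.
rewrite eA => H hH HA; have /set0Pn[u uH] := head_neq0 hH.
have [uD|uD] := boolP (u \in D); [left|right].
  exact: (head_in_district_union aA dD hH HA uH uD).
apply: (head_in_district_union aA (district_unionD dD) hH HA uH).
by rewrite inE uD (subsetP HA).
Qed.

Lemma eq_expansion_district A D x y : ancestral G A -> district_union G A D ->
  {in D :|: pa G D, x =1 y} -> expansion G q D x = expansion G q D y.
Proof.
move=> aA dD xy; have [DA _] := dD; apply: eq_expansion.
  by move=> v vD; apply: xy; rewrite inE vD.
move=> H hH HD; apply: (Hq hH).1 => v vT; apply: xy.
have /set0Pn[u uH] := head_neq0 hH; have uD := subsetP HD u uH.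
have := subsetP (head_tail_sub aA hH (subset_trans HD DA) uH) v vT.
move/(subsetP (district_tailS G (district_union_dis dD uD))).
by case/setUP=> [/setDP[vD _]|vP]; apply/setUP; [left|right].
Qed.

Lemma district_unionD1 A D v : district_union G A D -> v \in D ->
  district_union G (A :\ v) (D :\ v) /\ (A :\ v) :\: (D :\ v) = A :\: D.
Proof.
move=> dD vD; have [DA _] := dD; split.
  have -> : D :\ v = D :&: (A :\ v) by rewrite setIDA (setIidPl DA).
  exact: district_unionI (subD1set _ _).
apply/setP=> u; rewrite !inE; case: eqP => // ->; by rewrite vD.
Qed.

Hypothesis gm : global_markov G P.

Lemma markov_head A v x : ancestral G A -> v \in A -> an G (dis G A [set v]) = A ->
  barren G A \subset zeros A x -> tails_positive A x ->
  pr P (ev A x) = q (barren G A) x * pr P (ev (A :\: barren G A) x).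
Proof.
move=> aA vA eA zA tp; set D := dis G A [set v] in eA.
have eH : barren G A = barren G D by rewrite -{1}eA barren_an.
have dD : district_union G A D := dis_district_union G A v.
have hH : is_head G (barren G A) by rewrite eH; apply: dis_barren_head.
have HD : barren G A \subset D by rewrite eH barren_sub.
have eT : (D :|: pa G D) :\: barren G A = district_tail G D.
  rewrite /district_tail -eH setDUl; congr (_ :|: _); apply/setDidPl.
  apply/pred0P=> u /=; apply/negP=> /andP[/paP[w wD uw] uA].
  by rewrite (barren_dir uA (subsetP dD.1 w wD)) in uw.
have := district_markov x HP gm aA dD (subxx _) HD (head_neq0 hH); rewrite eT.
have T0 := tp v vA; rewrite -/D in T0.
have eHt : head_tail G (barren G A) = district_tail G D by rewrite eH dis_head_tail.
rewrite ((Hq hH).2 x) eHt // /cpr /ev0.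
have -> : ev (barren G A) [ffun=> false] = ev (barren G A) x.
  by apply: eq_ev => u /(subsetP zA)/zerosP[_ ->]; rewrite ffunE.
have -> : ev (barren G A) x :&: ev (district_tail G D) x = ev (D :|: pa G D) x.
  rewrite evU -eT; congr ev; rewrite -{1}(setIidPr (subset_trans HD (subsetUl _ (pa G D)))).
  exact: setID.
have Tn : pr P (ev (district_tail G D) x) != 0 by rewrite gt_eqF.
by move=> e; apply: (mulIf Tn); rewrite e; field.
Qed.

Lemma expansion_barren A v x : ancestral G A -> v \in A ->
  an G (dis G A [set v]) = A -> barren G A \subset zeros A x ->
  expansion G q A x = q (barren G A) x * expansion G q (A :\: barren G A) x.
Proof.
move=> aA vA eA zA; have hH : is_head G (barren G A).
  by rewrite -{1}eA barren_an; apply: dis_barren_head.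
apply: expansion_head => //; first exact: head_neq0 hH.
move=> C HC CA; apply/PhiP; split=> // H' hH' H'C HH'.
apply: (head_an_inj hH hH' HH'); rewrite an_barren.
exact: subset_trans (subset_trans H'C CA) (sub_an _ _).
Qed.

(** Let [A1] be the ancestors of the district [D] of [v], [K] the set [D] with its
parents, and [mb] the rest of [K] after removing [v].  When [mb] is not null,
the local Markov property at [v] in [A] and in [A1], together with the
factorizations of the expansions over [A], [A1] and both without [v], gives
the claim by cancelling P(X_mb = x_mb) and F(A1 \ D).  When [mb] is null, so is
the outcome on [A], and F(D) vanishes. *)
Lemma markov_district A v x :
  (forall A' y, ancestral G A' -> (#|A'| < #|A|)%N -> tails_positive A' y ->
     pr P (ev A' y) = expansion G q A' y) ->
  ancestral G A -> v \in barren G A -> tails_positive A x ->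
  an G (dis G A [set v]) != A -> pr P (ev A x) = expansion G q A x.
Proof.
move=> IH aA vA tp; set D := dis G A [set v]; set A1 := an G D => neA.
have vAA : v \in A by case/barrenP: vA.
have vD : v \in D by apply: dis_self.
have dD : district_union G A D := dis_district_union G A v.
have [DA _] := dD; have A1A : A1 \subset A by apply: ancestral_sub.
have DA1 : D \subset A1 := sub_an G D.
have aA1 : ancestral G A1 := an_ancestral G D.
have dD1 : district_union G A1 D.
  by rewrite -(setIidPl DA1); apply: district_unionI A1A.
have vA1 : v \in barren G A1 by apply: barrenS A1A _ vA; apply: (subsetP DA1).
have lt1 : (#|A1| < #|A|)%N by rewrite proper_card // properEneq neA.
have eb : barren G A1 = barren G D by rewrite barren_an.
set K := D :|: pa G D; set mb := K :\ v.
have KA1 : K \subset A1 by rewrite subUset DA1 pa_sub.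
have nb w : w \in barren G A1 -> w \notin pa G (A1 :\: D) /\ w \notin pa G D.
  move=> wb; split; apply/negP=> /paP[u uD wu]; move: wu.
    by rewrite (barren_dir wb) //; case/setDP: uD.
  by rewrite (barren_dir wb) // (subsetP DA1).
have pos y B : 0 < P y -> tails_positive B y by move=> y0 u _; apply: pr_ev_gt0.
(* The induction hypothesis for A1 at an outcome that agrees with x on K and
   with y elsewhere; the change at maximal elements of D affects no tail. *)
have key y : 0 < P y -> {in district_tail G D, y =1 x} ->
    expansion G q (A1 :\: D) y != 0 /\
    pr P (ev A1 (mix K x y)) = expansion G q D x * expansion G q (A1 :\: D) y.
  move=> y0 yx; split.
    have := pr_ev_gt0 HP A1 y0; rewrite (IH A1) //; last exact: pos.
    by rewrite (expansion_district _ aA1 dD1); apply: contraTneq => ->; rewrite mulr0 ltxx.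
  have e w : w \notin barren G A1 -> y w = mix K x y w.
    move=> wb; rewrite ffunE; case: ifP => // wK; apply: yx; apply/setUP.
    case/setUP: wK => [wD|]; [left|by right].
    by rewrite inE wD -eb wb.
  rewrite (IH A1) //; last exact: (tails_positive_barren e (pos y A1 y0)).
  rewrite (expansion_district _ aA1 dD1); congr (_ * _).
    by apply: (eq_expansion_district aA1 dD1); apply: mix_in.
  apply: (eq_expansion_district aA1 (district_unionD dD1)) => w wK.
  apply/esym/e; apply: contraL wK => wb; have [np _] := nb w wb.
  by rewrite in_setU negb_or np andbT inE negb_and negbK; apply/orP; left;
    move: wb; rewrite eb => /barrenP[].
have mbK : mb \subset K by apply: subD1set.
have mbA : mb \subset A := subset_trans (subset_trans mbK KA1) A1A.
(* In the null case y is only known to agree with x on the tail of D, and the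
   expansion over A1 at the mixed outcome is zero because K contains mb. *)
have [m0|] := ltP 0 (pr P (ev mb x)); last first.
  move=> m0; have {}m0 : pr P (ev mb x) = 0 by apply: le_anti; rewrite m0 pr_ge0.
  have [y /evP yT y0] := pr_gt0P HP (tp v vAA).
  have [k0 ek] := key y y0 yT.
  have e0 : pr P (ev A1 (mix K x y)) = 0.
    apply: le_anti; rewrite pr_ge0 // andbT -m0.
    rewrite -(@eq_ev _ mb (mix K x y) x); first exact/pr_evS/(subset_trans mbK).
    by move=> w /(subsetP mbK); apply: mix_in.
  move/esym/eqP: ek; rewrite e0 mulf_eq0 (negbTE k0) orbF => /eqP fD.
  rewrite (expansion_district _ aA dD) fD mul0r.
  by apply: le_anti; rewrite pr_ge0 // andbT -m0 pr_evS.
have [y /evP ym y0] := pr_gt0P HP m0.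
have Tm : district_tail G D \subset mb.
  apply/subsetP=> w wT; rewrite in_setD1; apply/andP; split.
    by apply: contraTneq wT => ->; apply: district_tail_barren vA1.
  by case/setUP: wT => [/setDP[wD _]|wP]; apply/setUP; [left|right].
have [k0 ek] := key y y0 (fun w wT => ym w (subsetP Tm w wT)).
have B1 : [set v] \subset barren G A by rewrite sub1set.
have B2 : [set v] \subset barren G A1 by rewrite sub1set.
have BD : [set v] \subset D by rewrite sub1set.
have n0 : [set v] != set0 by apply/set0Pn; exists v; rewrite inE.
have e1 := district_markov x HP gm aA dD B1 BD n0.
have := district_markov (mix K x y) HP gm aA1 dD1 B2 BD n0.
rewrite -/K -/mb in e1 *.
have -> : ev mb (mix K x y) = ev mb x.
  by apply: eq_ev => w /(subsetP mbK); apply: mix_in.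
have -> : ev K (mix K x y) = ev K x by apply/eq_ev/mix_in.
have -> : ev (A1 :\ v) (mix K x y) = ev (A1 :\ v) y.
  apply: eq_ev => w /setD1P[wv _]; rewrite ffunE; case: ifP => // wK.
  by rewrite ym // in_setD1 wv.
have [dv ev1] := district_unionD1 dD vD; have [dv1 ev2] := district_unionD1 dD1 vD.
have av := ancestral_setD aA B1; have av1 := ancestral_setD aA1 B2.
have ltv : (#|A :\ v| < #|A|)%N by rewrite [X in (_ < X)%N](cardsD1 v) vAA.
have ltv1 : (#|A1 :\ v| < #|A|)%N.
  by apply: leq_ltn_trans lt1; apply/subset_leq_card/subD1set.
rewrite ek (IH _ y av1 ltv1); last exact: pos.
rewrite (expansion_district _ av1 dv1) ev2.
move: e1; rewrite (IH _ x av ltv); last exact: tails_positiveS (subD1set _ _) tp.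
rewrite (expansion_district _ av dv) ev1 (expansion_district _ aA dD).
have -> : expansion G q (D :\ v) y = expansion G q (D :\ v) x.
  apply: (eq_expansion_district av1 dv1) => w wK; apply: ym.
  case/setUP: wK => [/setD1P[wv wD]|wP].
    by rewrite in_setD1 wv; apply/setUP; left.
  have wP' : w \in pa G D := subsetP (paS G (subD1set D v)) w wP.
  rewrite in_setD1 in_setU wP' orbT andbT; apply: contraTneq wP' => ->.
  by have [] := nb v vA1.
have mn : pr P (ev mb x) != 0 by rewrite gt_eqF.
move=> e1 e2; apply: (mulIf mn); apply: (mulIf k0); rewrite e1.
set fDv := expansion G q (D :\ v) x in e2 *.
set k := expansion G q (A1 :\: D) y in e2 *.
transitivity (expansion G q (A :\: D) x * (pr P (ev K x) * (fDv * k))); first by ring.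
by rewrite -e2; ring.
Qed.

Lemma markov_expansion A x : ancestral G A -> tails_positive A x ->
  pr P (ev A x) = expansion G q A x.
Proof.
have [n] := ubnP #|A|; elim: n A x => // n IH A x /ltnSE An aA.
have {}IH A' y : ancestral G A' -> (#|A'| < #|A|)%N -> tails_positive A' y ->
    pr P (ev A' y) = expansion G q A' y.
  by move=> aA' lt; apply: IH => //; apply: leq_trans lt An.
have [m] := ubnP #|A :\: zeros A x|; elim: m x => // m IHm x /ltnSE xm tp.
have [->|A0] := eqVneq A set0; first by rewrite pr_ev_set0 // expansion0.
have [v vA] : exists v, v \in barren G A by apply/set0Pn; rewrite barren_eq0.
have vAA : v \in A by case/barrenP: vA.
have [zA|] := boolP (barren G A \subset zeros A x); last first.
  case/subsetPn=> w wb wz; have wA : w \in A by case/barrenP: wb.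
  have xw : x w by move: wz; rewrite inE wA negbK.
  set x' := mix [set w] [ffun=> false] x.
  have xx' u : u != w -> x' u = x u by move=> uw; rewrite mix_out // inE.
  have xw' : x' w = false by rewrite mix_in ?inE // ffunE.
  have wB : [set w] \subset barren G A by rewrite sub1set.
  rewrite (@expansion_one _ _ _ _ A w x x') ?xw' //; last first.
    move=> H hH HA; apply: (Hq hH).1 => u uT; apply: xx'.
    have /set0Pn[t tH] := head_neq0 hH.
    have uT' := subsetP (head_tail_sub aA hH HA tH) u uT.
    by apply: contraTneq uT' => ->; apply: district_tail_barren wb; apply: dis_sub.
  rewrite -(IH (A :\ w)); first last.
  - exact: tails_positiveS (subD1set _ _) tp.
  - by rewrite [X in (_ < X)%N](cardsD1 w) wA.
  - exact: ancestral_setD wB.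
  rewrite -IHm; first last.
  - apply: tails_positive_barren tp => u ub; apply/esym/xx'.
    by apply: contraNneq ub => ->.
  - apply: leq_trans xm; apply: proper_card; apply/properP; split.
      apply/subsetP=> u; rewrite !inE; have [->|/xx' ->//] := eqVneq u w.
      by rewrite xw' wA.
    by exists w; rewrite !inE wA ?xw ?xw'.
  by rewrite (@pr_evD1 _ _ P A w x x') ?xw ?xw' // addrK.
have [eA|neA] := eqVneq (an G (dis G A [set v])) A; last first.
  exact: (markov_district IH aA vA).
rewrite (markov_head aA vAA eA zA tp) (expansion_barren aA vAA eA zA) IH //.
- exact: ancestral_setD.
- rewrite proper_card //; apply/properP; split; first exact: subsetDl.
  by exists v => //; rewrite inE vA.
by apply: tails_positiveS tp; apply: subsetDl.
Qed.

End Forward.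


(** * From the expansion to the Markov property *)

Section Backward.
Variables (R : realFieldType) (V : finType) (G : admg V) (P : state V -> R).
Variable q : {set V} -> state V -> R.
Hypothesis HP : is_prob P.
Hypothesis Hq : forall H : {set V}, is_head G H ->
  cond_version P (ev0 H) (head_tail G H) (q H).
Implicit Types (A B C D U H : {set V}) (x y z : state V).

(** Where some tail is null, the expansion depends on the versions [q] and need
not match P, which is zero there; so the factor is set to zero. *)
Definition factor A U x : R :=
  if [forall v in U, 0 < pr P (ev (district_tail G (dis G A [set v])) x)]
  then expansion G q U x else 0.

Lemma eq_factor A U x y : ancestral G A -> district_union G A U ->
  {in U :|: pa G U, x =1 y} -> factor A U x = factor A U y.
Proof.
move=> aA dU xy; rewrite /factor (eq_expansion_district Hq aA dU xy).
congr (if _ then _ else _); apply: eq_forallb_in => v vU.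
rewrite (@eq_ev _ _ x y) // => w wT; apply: xy.
have := subsetP (district_tailS G (district_union_dis dU vU)) w wT.
by case/setUP=> [/setDP[wU _]|wP]; apply/setUP; [left|right].
Qed.

Lemma factorize A U x : ancestral G A -> district_union G A U ->
  (tails_positive G P A x -> pr P (ev A x) = expansion G q A x) ->
  pr P (ev A x) = factor A U x * factor A (A :\: U) x.
Proof.
move=> aA dU E; have [UA _] := dU; rewrite /factor.
have null v : v \in A -> ~~ (0 < pr P (ev (district_tail G (dis G A [set v])) x)) ->
    pr P (ev A x) = 0.
  rewrite -leNgt => vA T0; apply: le_anti; rewrite pr_ge0 // andbT.
  apply: le_trans T0; apply: pr_evS => //.
  by apply: district_tail_sub => //; apply: dis_sub.
case: ifPn => [/forall_inP p1|/forall_inPn[v vU]]; last first.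
  by rewrite mul0r; apply: null; apply: (subsetP UA).
case: ifPn => [/forall_inP p2|/forall_inPn[v /setDP[vA _]]]; last first.
  by rewrite mulr0; apply: null.
rewrite -expansion_district //; apply: E => v vA.
by have [/p1|vU] := boolP (v \in U); last by apply: p2; rewrite inE vU.
Qed.

Lemma expansion_markov :
  (forall A x, ancestral G A -> tails_positive G P A x ->
     pr P (ev A x) = expansion G q A x) -> global_markov G P.
Proof.
move=> E A B C _ AC _ _ _ sep; set A0 := an G (A :|: B :|: C).
have aA0 : ancestral G A0 := an_ancestral _ _.
set S := reach_set G A B C.
(* The cliques of the augmented graph of A0, on which the factors depend. *)
pose K v := dis G A0 [set v] :|: pa G (dis G A0 [set v]).
pose U := [set v in A0 | ~~ [disjoint K v & S]].
have KK u w : u \in A0 -> w \in A0 -> bi G u w -> K u = K w.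
  move=> uA wA uw; rewrite /K (@dis_eq _ G A0 w u) //.
  have [_] := dis_district_union G A0 w; apply; first exact: (dis_self G wA).
  - by [].
  by rewrite bi_sym.
have dU : district_union G A0 U.
  split; first by apply/subsetP=> v /setIdP[].
  move=> u w /setIdP[uA Ku] wA uw; apply/setIdP; split=> //.
  by rewrite -(KK u w).
have inK (W : {set V}) w : W \subset A0 -> w \in W :|: pa G W ->
    exists2 v, v \in W & w \in K v.
  move=> WA /setUP[wW|/paP[v vW wv]]; [exists w|exists v] => //;
    apply/setUP; [left|right].
    by apply: dis_self; apply: (subsetP WA).
  by apply/paP; exists v => //; apply: dis_self; apply: (subsetP WA).
apply: (@factor_cond_indep _ _ _ HP A0 S A B C (factor A0 U) (factor A0 (A0 :\: U))).
- move=> x y xy; apply: eq_factor => // w wU; apply: xy.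
  have [v /setIdP[vA Kv] wK] := inK U w dU.1 wU.
  exact: (subsetP (reach_set_closed AC sep vA Kv)).
- move=> x y xy; apply: (eq_factor aA0 (district_unionD dU)) => w wU; apply: xy.
  have [v /setDP[vA vU] wK] := inK _ w (subsetDl _ _) wU.
  rewrite inE; apply: contra vU => wS; apply/setIdP; split=> //.
  by apply/pred0Pn; exists w; rewrite /= wK wS.
- by move=> x; apply: factorize => //; apply: E.
- exact: reach_set_sub.
- exact: reach_set_disjoint.
- exact: reach_set_given.
exact: sub_an.
Qed.

End Backward.

Theorem theorem5p1 (R : realFieldType) (V : finType) (G : admg V)
    (P : state V -> R) (HP : is_prob P)
    (q : {set V} -> state V -> R)
    (Hq : forall H : {set V}, is_head G H ->
            cond_version P (ev0 H) (head_tail G H) (q H)) :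
  global_markov G P <->
  (forall (A : {set V}) (x : state V),
     ancestral G A -> expansion_defined G P A x ->
     pr P (ev A x) =
       \sum_(C : {set V} | (zeros A x \subset C) && (C \subset A))
          (-1) ^+ #|C :\: zeros A x| * \prod_(H in hpart G C) q H x).
Proof.
split=> [gm A x aA /(expansion_definedE HP x aA) tp|E].
  exact: (markov_expansion HP Hq gm).
apply: (expansion_markov HP Hq) => A x aA tp; apply: E => //.
exact/(expansion_definedE HP x aA).
Qed.
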